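(* Let $M$ be an oriented one-cusped hyperbolic 3-manifold with trace field $F$, $\mathcal T$ an ideal triangulation of $M$ supporting the geometric representation, $\alpha:\pi_1(M)\to\mathbb Z$ an epimorphism and $\mu$ a peripheral curve with $\alpha(\mu)=1$. Let $\mathcal T^{(n)}$ be the induced ideal triangulation of the $n$-fold cyclic cover $M^{(n)}$. Then for all $n\ge 1$, $$\tau^{\mathrm{CS}}(\mathcal T^{(n)},t^n)=\prod_{\omega^n=1}\tau^{\mathrm{CS}}(\mathcal T,\omega\,t)$$ (equality up to multiplication by $\pm t^r$, $r\in\mathbb Z$), where the product is over all complex $n$-th roots of unity $\omega$.
   Context: $M$ is an oriented (complete, finite volume) hyperbolic 3-manifold with one torus cusp. An ideal triangulation $\mathcal T$ of $M$ with $N$ tetrahedra $\Delta_1,\dots,\Delta_N$ has exactly $N$ edges $e_1,\dots,e_N$. A quad type of a tetrahedron is a pair of opposite edges. Fixing a quad type of each oriented tetrahedron $\Delta_j$, the pairs of opposite edges of $\Delta_j$ are labelled by shape parameters $z_j,\ z_j'=\frac1{1-z_j},\ z_j''=1-\frac1{z_j}$ with $z_j\in\mathbb C\setminus\{0,1\}$ (the chosen quad type gets $z_j$; seen from each ideal vertex the labels occur in the counterclockwise cyclic order $z_j,z'_j,z''_j$). The symbol $\square$ stands for no prime, one prime or two primes. $\mathbf G^\square$ is the $N\times N$ matrix whose $(i,j)$-entry is the number of edges of $\Delta_j$ labelled $z_j^\square$ incident (identified) to $e_i$. A peripheral curve is an oriented homotopically non-trivial simple closed curve in the peripheral torus. For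 a peripheral curve $\gamma$, in normal position with respect to the triangulation of the peripheral torus induced by $\mathcal T$, $\mathbf C_\gamma^\square\in\mathbb Z^N$ is the row vector whose $j$-th entry is the signed number of triangle corners labelled $z_j^\square$ cut off by $\gamma$ (sign $+$ or $-$ according to whether the corner lies to the left or right of $\gamma$). $\mathcal T$ supports the geometric representation if there are shapes $z_j$ satisfying the gluing equations $\prod_j\prod_\square (z_j^{\square})^{\mathbf G^\square_{ij}}=1$ for all $i$ (logarithmically, $\sum_j\sum_\square \mathbf G^\square_{ij}\log z_j^\square=2\pi\sqrt{-1}$) and the completeness equations ($\sum_j\sum_\square \mathbf C^\square_{\gamma j}\log z^\square_j=0$), whose holonomy is the geometric (discrete faithful) representation of $\pi_1(M)$; these shapes are used below. Put $\zeta_j=\frac1{z_j}$, $\zeta_j'=\frac1{1-z_j}$, $\zeta_j''=\frac1{z_j(z_j-1)}$, and $\mathrm{diag}(\zeta^\square)=\mathrm{diag}(\zeta_1^\square,\dots,\zeta_N^\square)$. A combinatorial flattening of $\mathcal T$ is a triple $(f,f',f'')$ of column vectors in $\mathbb Z^N$ with $\mathbf Gf+\mathbf G'f'+\mathbf G''f''=(2,\dots,2)^T$, $f+f'+f''=(1,\dots,1)^T$, and $\mathbf C_\gamma f+\mathbf C'_\gamma f'+\mathbf C''_\gamma f''=0$ for every peripheral curve $\gamma$; these always exist. $\widetilde M$ and $M^{(n)}$ are the covers of $M$ corresponding to $\alpha^{-1}(0)$ and $\alpha^{-1}(n\mathbb Z)$, with lifted ideal triangulations $\widetilde{\mathcal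 T}$ and $\mathcal T^{(n)}$; the deck group $\mathbb Z$ of $\widetilde M\to M$ is generated by the action of $\mu$. Choose lifts $\widetilde e_i,\widetilde\Delta_j$ to $\widetilde{\mathcal T}$. $\mathbf G_k^\square$ is the $N\times N$ matrix whose $(i,j)$-entry is the number of edges of $\mu^k\cdot\widetilde\Delta_j$ labelled $z_j^\square$ incident to $\widetilde e_i$, and $\mathbf G^\square(t)=\sum_{k\in\mathbb Z}\mathbf G_k^\square t^k$. The twisted 1-loop invariant is $$\tau^{\mathrm{CS}}(\mathcal T,t)=\frac{\det\big(\mathbf G(t)\,\mathrm{diag}(\zeta)+\mathbf G'(t)\,\mathrm{diag}(\zeta')+\mathbf G''(t)\,\mathrm{diag}(\zeta'')\big)}{\prod_{j=1}^N\zeta_j^{f_j}\zeta_j'^{f_j'}\zeta_j''^{f_j''}}\in F[t^{\pm1}]/(\pm t^{\mathbb Z}),$$ where $/(\pm t^{\mathbb Z})$ means up to multiplication by $\pm t^r$, $r\in\mathbb Z$; modulo this it is independent of the choices of flattening, quad types and lifts. For $M^{(n)}$ (again one-cusped), $\tau^{\mathrm{CS}}(\mathcal T^{(n)},\cdot)$ is the same invariant defined using the lifted shapes, the epimorphism $\frac1n\alpha|_{\pi_1(M^{(n)})}:\pi_1(M^{(n)})\to\mathbb Z$, whose infinite cyclic cover is again $\widetilde M$ with deck group generated by $\mu^n$; $\tau^{\mathrm{CS}}(\mathcal T^{(n)},t^n)$ is obtained by substituting $t^n$ for its variable. *)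

(* Defs.v *)
From Stdlib Require Export Relation_Operators.
From HB Require Export structures.
From mathcomp Require Export all_boot all_order all_fingroup all_algebra.
From mathcomp Require Export complex.
From mathcomp Require Export all_classical all_reals all_analysis.
Export Order.TTheory GRing.Theory Num.Theory numFieldNormedType.Exports.

Set Implicit Arguments.
Unset Strict Implicit.
Unset Printing Implicit Defensive.

Local Open Scope ring_scope.
Local Open Scope complex_scope.

(** [T j f = (j', s)]: the face of the tetrahedron [j] opposite to its vertex
    [f] is glued to the face of [j'] opposite to [s f]; each vertex [u != f] of
    [j] goes to the vertex [s u] of [j'].  The carrier [D] is the set of
    tetrahedra; it is infinite for the infinite cyclic cover.

    Every tetrahedron is oriented so that its vertices 1, 2, 3 occur
    counterclockwise when seen from the vertex 0. *)
Definition gluing (D : Type) := D -> 'I_4 -> D * {perm 'I_4}.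

(** [(j, (u, v))] is the edge of the tetrahedron [j] from [u] to [v].  It also
    stands for the corner at [v] of the triangle cut off by the vertex [u]. *)
Definition tedge (D : Type) : Type := D * ('I_4 * 'I_4).

Section Triangulation.
Variables (D : Type) (T : gluing D).

Inductive glue_edge : tedge D -> tedge D -> Prop :=
  GlueEdge j f u v of f != u & f != v :
    glue_edge (j, (u, v)) ((T j f).1, ((T j f).2 u, (T j f).2 v)).

Definition corner_eq := clos_refl_sym_trans _ glue_edge.

Definition edge_eq := clos_refl_sym_trans _
  (fun x y => glue_edge x y \/ y = (x.1, (x.2.2, x.2.1))).

Inductive glue_vertex : D * 'I_4 -> D * 'I_4 -> Prop :=
  GlueVertex j f v of f != v :
    glue_vertex (j, v) ((T j f).1, (T j f).2 v).

Definition vertex_eq := clos_refl_sym_trans _ glue_vertex.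

(** Opposite edges of a tetrahedron have the same [quad]: 0 for 01|23,
    1 for 02|13, 2 for 03|12.  Seen from any of the four vertices, the edges of
    quads 0, 1, 2 occur counterclockwise in this cyclic order. *)
Definition quad (u v : 'I_4) : 'I_3 :=
  inord (if u == 0%N :> nat then v.-1
         else if v == 0%N :> nat then u.-1 else (5 - u - v)%N).

(** The number of edges of [x], in the quad [k], incident to the edge [e]. *)
Definition nedges (x : D) (k : 'I_3) (e : tedge D) : nat :=
  #|[set uv : 'I_4 * 'I_4 | [&& (uv.1 < uv.2)%N, quad uv.1 uv.2 == k
                              & `[< edge_eq (x, uv) e >]]]|.

(** A dual path is the sequence of the faces it crosses.  A state [(j, None)]
    is a tetrahedron; a state [(j, Some v)] is the triangle cut off by the
    vertex [v] of [j], so that words read from it are paths in the peripheral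
    torus, where the face opposite to [v] cannot be crossed. *)

Definition cross (x : D * option 'I_4) (f : 'I_4) : D * option 'I_4 :=
  ((T x.1 f).1, omap (T x.1 f).2 x.2).

Definition walk := foldl cross.

(** [(j, f, g)]: in the tetrahedron [j], having entered through the face [f] and
    about to leave through [g]; the edge common to [f] and [g] is turned
    around. *)
Definition turn (s : D * 'I_4 * 'I_4) : D * 'I_4 * 'I_4 :=
  let: (j, f, g) := s in ((T j g).1, (T j g).2 g, (T j g).2 f).

Inductive relator : D * option 'I_4 -> seq 'I_4 -> Prop :=
| Backtrack j ov f of Some f != ov :
    relator (j, ov) [:: f; (T j f).2 f]
| EdgeLoop j ov f g m of f != g & Some f != ov & Some g != ov
    & iter m turn (j, f, g) = (j, f, g) :
    relator (j, ov) [seq s.2 | s <- traject turn (j, f, g) m].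

Inductive insert_relator (x : D * option 'I_4) : seq 'I_4 -> seq 'I_4 -> Prop :=
  InsertRelator w1 r w2 of relator (walk x w1) r :
    insert_relator x (w1 ++ w2) (w1 ++ r ++ w2).

(** Homotopy of dual paths starting at [x]: in the manifold if [x = (j, None)],
    in the peripheral torus if [x = (j, Some v)]. *)
Definition homotopic x := clos_refl_sym_trans _ (insert_relator x).

Definition is_loop (j : D) (w : seq 'I_4) := (walk (j, None) w).1 = j.

Fixpoint evalc (a : D -> 'I_4 -> int) (j : D) (w : seq 'I_4) : int :=
  if w is f :: w' then a j f + evalc a (T j f).1 w' else 0.

(** A homomorphism from the fundamental group to Z is given by a 1-cocycle of
    the dual cell structure: [a j f] is the value on crossing [f] out of [j]. *)
Definition cocycle (a : D -> 'I_4 -> int) :=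
  forall j r, relator (j, None) r -> evalc a j r = 0.

Definition epimorphism (a : D -> 'I_4 -> int) :=
  cocycle a /\ forall j k, exists2 w, is_loop j w & evalc a j w = k.

End Triangulation.

Section FiniteTriangulation.
Variables (D : finType) (T : gluing D).

Definition oriented_gluing := forall j f,
  [/\ T (T j f).1 ((T j f).2 f) = (j, (T j f).2^-1%g),
      odd_perm (T j f).2 & ((T j f).1, (T j f).2 f) != (j, f)].

(** The vertex links are tiled by [4 * #|D|] triangles, with each of the
    [12 * #|D|] sides of the triangles shared by two of them. *)
Definition link_euler_char : int :=
  #|[set [set y | `[< corner_eq T x y >]]
      | x in [set x : D * ('I_4 * 'I_4) | x.2.1 != x.2.2]]|%:Z
  - (6 * #|D|)%:Z + (4 * #|D|)%:Z.

Definition one_torus_cusp :=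
  (forall x y : D * 'I_4, vertex_eq T x y) /\ link_euler_char = 0.

Definition ideal_triangulation := oriented_gluing /\ one_torus_cusp.

Definition edge_enum (e : 'I_#|D| -> tedge D) :=
  (forall i, (e i).2.1 != (e i).2.2) /\
  (forall x : tedge D, x.2.1 != x.2.2 -> exists! i, edge_eq T x (e i)).

(** [(j, v, (f, g))]: an arc in the triangle cut off by the vertex [v] of [j],
    entering through its side on the face [f] and leaving through its side on
    the face [g].  It cuts off the corner at the remaining vertex [w]; the edge
    [vw] has the same quad as the opposite edge [fg]. *)
Definition arc : Type := ((D * 'I_4) * ('I_4 * 'I_4))%type.

Definition arc_quad (x : arc) : 'I_3 := quad x.2.1 x.2.2.

(** If the corners [f], [g], [w] are in counterclockwise order then [w] is on the
    right of the arc. *)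
Definition arc_sign (x : arc) : int :=
  if quad x.1.2 x.2.2 == quad x.1.2 x.2.1 + 1 then -1 else 1.

Definition closed_normal_curve m (c : 'I_m.+1 -> arc) := forall i : 'I_m.+1,
  let: ((j, v), (f, g)) := c i in
  [/\ uniq [:: v; f; g],
      (c (ordS i)).1 = ((T j g).1, (T j g).2 v)
    & (c (ordS i)).2.1 = (T j g).2 g].

Definition curve_word m (c : 'I_m.+1 -> arc) := [seq (c i).2.2 | i <- enum 'I_m.+1].

Definition between (R : realType) (a b x : R) :=
  (Num.min a b < x) && (x < Num.max a b).

(** The chords [ab] and [a'b'] of a disc, with end points given by coordinates
    on the boundary circle, are disjoint. *)
Definition unlinked (R : realType) (a b a' b' : R) :=
  [&& a' != a, a' != b, b' != a, b' != b & between a b a' == between a b b'].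

(** The perimeter of the triangle at [v] has a counterclockwise coordinate in
    [0, 3]: the side on the face [f] is [[k, k + 1]] for [k = quad v f].  The
    curve enters the triangle of [c i] at the point [y i] of the side; as gluing
    reverses the orientation of the sides, it leaves the preceding triangle at
    the point [1 - y i] of the side. *)
Definition embedded (R : realType) m (c : 'I_m.+1 -> arc) :=
  exists2 y : 'I_m.+1 -> R, (forall i, 0 < y i < 1) &
  let side i f : R := (quad (c i).1.2 f)%:R in
  let enter i := side i (c i).2.1 + y i in
  let leave i := side i (c i).2.2 + (1 - y (ordS i)) in
  forall i k, i != k -> (c i).1 = (c k).1 ->
    unlinked (enter i) (leave i) (enter k) (leave k).

Definition peripheral_curve (R : realType) m (c : 'I_m.+1 -> arc) :=
  [/\ closed_normal_curve c, embedded R c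
    & ~ homotopic T ((c ord0).1.1, Some (c ord0).1.2) (curve_word c) [::]].

(** [q j] is the quad type chosen in the tetrahedron [j], and [p : 'I_3] is the
    number of primes: the edges of [j] labelled by the shape parameter with [p]
    primes are those of quad [q j + p] (modulo 3). *)
Variable q : D -> 'I_3.

Definition gluing_mx (e : 'I_#|D| -> tedge D) (p : 'I_3) : 'M[int]_#|D| :=
  \matrix_(i, j) (nedges T (enum_val j) (q (enum_val j) + p) (e i))%:Z.

Definition curve_mx m (c : 'I_m.+1 -> arc) (p : 'I_3) : 'rV[int]_#|D| :=
  \row_j \sum_(i | ((c i).1.1 == enum_val j)
                   && (arc_quad (c i) == q (enum_val j) + p)) arc_sign (c i).

Definition flattening (R : realType) (e : 'I_#|D| -> tedge D)
    (f : 'I_3 -> 'cV[int]_#|D|) :=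
  [/\ \sum_p gluing_mx e p *m f p = const_mx 2,
      \sum_p f p = const_mx 1
    & forall m (c : 'I_m.+1 -> arc), peripheral_curve R c ->
        \sum_p curve_mx c p *m f p = 0].

End FiniteTriangulation.

Section Geometry.
Local Open Scope classical_set_scope.
Variable R : realType.
Local Notation C := R[i].

Definition cexp (x : C) : C :=
  (expR (complex.Re x))%:C * (cos (complex.Im x) +i* sin (complex.Im x)).

(** The shape parameter with [p] primes. *)
Definition shape (z : C) (p : 'I_3) : C :=
  match val p with 0%N => z | 1%N => (1 - z)^-1 | _ => 1 - z^-1 end.

Variables (D : finType) (T : gluing D).

(** The logarithms are branches with [log z + log z' + log z'' = pi * 'i]; no
    sign condition is put on the imaginary part of the shapes. *)
Definition log_gluing_equations (q : D -> 'I_3) (e : 'I_#|D| -> tedge D)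
    (z : D -> C) :=
  exists L : 'I_3 -> 'cV[C]_#|D|,
  [/\ forall p j, cexp (L p j 0) = shape (z (enum_val j)) p,
      \sum_p L p = const_mx (pi%:C * 'i),
      \sum_p map_mx intr (gluing_mx T q e p) *m L p = const_mx (2 * pi%:C * 'i)
    & forall m (c : 'I_m.+1 -> arc D), peripheral_curve T R c ->
        \sum_p map_mx intr (curve_mx q c p) *m L p = 0].

(** Homogeneous coordinates of the vertices of the ideal tetrahedron
    [oo, 0, 1, x], whose edge 01 has shape parameter [x]. *)
Definition ideal_vertex (x : C) (u : 'I_4) : 'cV[C]_2 :=
  \col_i (match val u, val i with
          | 0%N, 0%N => 1 | 0%N, _ => 0
          | 1%N, 0%N => 0 | 2%N, 0%N => 1 | _, 0%N => x
          | _, _ => 1 end).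

(** [H j f] represents the Moebius transformation placing the neighbour of [j]
    across [f] next to [j].  In [j] the edge 01 has shape [shape (z j) (- q j)]
    because the quad [q j] has shape [z j]. *)
Definition face_pairings (q : D -> 'I_3) (z : D -> C)
    (H : D -> 'I_4 -> 'M[C]_2) :=
  let vertex j := ideal_vertex (shape (z j) (- q j)) in
  forall j f, H j f \in unitmx /\
    forall u, u != f -> exists k : C,
      H j f *m vertex (T j f).1 ((T j f).2 u) = k *: vertex j u.

Fixpoint holonomy (H : D -> 'I_4 -> 'M[C]_2) (j : D) (w : seq 'I_4) : 'M[C]_2 :=
  if w is f :: w' then H j f *m holonomy H (T j f).1 w' else 1%:M.

(** The SL(2, C) representatives of the image of the fundamental group based
    at [j]. *)
Definition holonomy_group H (j : D) : set 'M[C]_2 :=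
  [set A | \det A = 1 /\ exists w k, is_loop T j w /\ A = k *: holonomy H j w].

Definition faithful_holonomy H := forall j w, is_loop T j w ->
  is_scalar_mx (holonomy H j w) -> homotopic T (j, None) w [::].

Definition discrete_group (Gamma : set 'M[C]_2) := exists2 eps : C, 0 < eps &
  forall A, Gamma A -> (forall i k, `|A i k - (1%:M : 'M[C]_2) i k| < eps) ->
    is_scalar_mx A.

(** The action of SL(2, C) on the upper half-space [{(x, y, h) | 0 < h}]. *)
Definition half_space_action (A : 'M[C]_2) (P : R * R * R) : R * R * R :=
  let u := P.1.1 +i* P.1.2 in
  let h := P.2%:C in
  let den := A 1 0 * u + A 1 1 in
  let n := den * den^* + A 1 0 * (A 1 0)^* * h ^+ 2 in
  let u' := ((A 0 0 * u + A 0 1) * den^* + A 0 0 * (A 1 0)^* * h ^+ 2) / n in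
  (complex.Re u', complex.Im u', complex.Re (h / n)).

Definition finite_covolume (Gamma : set 'M[C]_2) :=
  exists F : set (measurableTypeR R * measurableTypeR R * measurableTypeR R),
  [/\ measurable F, F `<=` [set P | 0 < P.2],
      (\int[(lebesgue_measure \x lebesgue_measure) \x lebesgue_measure]_(P in F)
          ((P.2 : R) ^- 3)%:E < +oo)%E
    & forall P : R * R * R, 0 < P.2 ->
        exists2 A, Gamma A & F (half_space_action A P)].

(** A discrete faithful holonomy of finite covolume identifies the manifold with
    a complete hyperbolic manifold of finite volume, and is the geometric
    representation. *)
Definition supports_geometric q e (z : D -> C) :=
  [/\ forall j, z j != 0 /\ z j != 1,
      log_gluing_equations q e z
    & exists H, [/\ face_pairings q z H, faithful_holonomy H
        & forall j, discrete_group (holonomy_group H j)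
                    /\ finite_covolume (holonomy_group H j)]].

End Geometry.

(** Crossing [f] out of [(j, k)] leads to the sheet [k + a j f]; the generator
    of the deck group is [k |-> k + 1]. *)
Definition cover (D : Type) (A : zmodType) (T : gluing D) (a : D -> 'I_4 -> A) :
    gluing (D * A) :=
  fun x f => (((T x.1 f).1, x.2 + a x.1 f), (T x.1 f).2).

Definition infinite_cyclic_cover (D : Type) (T : gluing D)
    (a : D -> 'I_4 -> int) : gluing (D * int) :=
  cover T a.

Definition proj_edge (D B : Type) (x : tedge (D * B)) : tedge D := (x.1.1, x.2).
Arguments proj_edge {D B} x.

(** The cover of degree [n.+1]. *)
Definition cyclic_cover (D : Type) (T : gluing D) (a : D -> 'I_4 -> int)
    (n : nat) : gluing (D * 'I_n.+1) :=
  cover T (fun j f => (Zp1 : 'I_n.+1) *~ a j f).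
Arguments cyclic_cover {D} T a n _ _.

(** [b] represents [(n.+1)^-1 * a] on the fundamental group of the cover of
    degree [n.+1]. *)
Definition divided_cocycle (D : Type) (T : gluing D) (a : D -> 'I_4 -> int)
    (n : nat) (b : D * 'I_n.+1 -> 'I_4 -> int) :=
  cocycle (cyclic_cover T a n) b /\
  forall x w, is_loop (cyclic_cover T a n) x w ->
    n.+1%:Z * evalc (cyclic_cover T a n) b x w = evalc T a x.1 w.

(** If [z] are the shapes for the quad types [q], these are the lifted shapes
    for the quad types [q']. *)
Definition lift_shape (R : realType) (D B : Type) (q : D -> 'I_3)
    (z : D -> R[i]) (q' : D * B -> 'I_3) (x : D * B) : R[i] :=
  shape (z x.1) (q' x - q x.1).

Section Twisted.
Variable R : realType.
Local Notation C := R[i].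

(** Laurent polynomials over [C] live in [C(t)].  Substitutions for [t] are
    expressed by evaluating at a nonzero element of [C(t)]. *)
Definition Ct : fieldType := {fraction {poly C}}.
Definition cst (c : C) : Ct := tofrac c%:P.
Definition indet : Ct := tofrac 'X.

Definition eq_upto_unit (x y : Ct) :=
  exists (s : bool) (r : int), x = (-1) ^+ s * indet ^ r * y.

Definition zeta (z : C) (p : 'I_3) : C :=
  match val p with
  | 0%N => z^-1 | 1%N => (1 - z)^-1 | _ => (z * (z - 1))^-1
  end.

Variables (D : finType) (T : gluing D) (a : D -> 'I_4 -> int).

(** [(j, s j)] is the chosen lift of the tetrahedron [j], and [e i] is the chosen
    lift of the [i]-th edge. *)
Variables (q : D -> 'I_3) (s : D -> int) (e : 'I_#|D| -> tedge (D * int)).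

Definition edge_lifts := edge_enum T (proj_edge \o e).

Definition twisted_gluing_coef (p : 'I_3) (k : int) : 'M[nat]_#|D| :=
  \matrix_(i, j) nedges (infinite_cyclic_cover T a)
    (enum_val j, s (enum_val j) + k) (q (enum_val j) + p) (e i).

Definition twisted_gluing_mx (p : 'I_3) (x : Ct) : 'M[Ct]_#|D| :=
  \matrix_(i, j)
    \sum_(k \in [set: int]%classic) (twisted_gluing_coef p k i j)%:R * x ^ k.

Definition tau (z : D -> C) (f : 'I_3 -> 'cV[int]_#|D|) (x : Ct) : Ct :=
  \det (\sum_p twisted_gluing_mx p x
          *m diag_mx (\row_j cst (zeta (z (enum_val j)) p)))
  / \prod_j \prod_p cst (zeta (z (enum_val j)) p) ^ f p j 0.

End Twisted.

(* Main.v *)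
(** Numerators.  The infinite cyclic covers of [M] and of its cyclic cover of
    degree [n] are the same triangulation.  An edge of the latter cover is an
    edge of [M] with a height modulo [n], so up to units its twisted matrix at
    [t^n] has as entries the parts of the entries of the twisted matrix of [M]
    with exponents in a given class modulo [n].  A Fourier transform in this
    class turns it into the block diagonal matrix of the twisted matrices of [M]
    at [w t] for [w^n = 1].

    Denominators.  The discrepancy between a flattening of the cover and the lift
    of a flattening [f] of [M] is pushed forward to [M], to an integral vector [d]
    in the kernel of the gluing equations.  With [L] the logarithms of the shapes,
    [U = L - pi i f] solves the homogeneous gluing and cusp equations.  It then
    integrates over the vertex links to logarithms of side lengths of the corner
    triangles, and from there, as for Penner's lambda lengths, to weights of the
    edges of [M] of which [U] is the image under the transpose of the gluing
    matrix.  Hence the pairing of [U] with [d] is a combination of the gluing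
    equations of [d] and vanishes, the pairing of [L] with [d] is in [pi i Z], and
    the product of the powers [zeta^d] is [1] or [-1]. *)

Require Import Defs.
From mathcomp Require Import separable cyclic cyclotomic finmap zify ring.

Set Implicit Arguments.
Unset Strict Implicit.
Unset Printing Implicit Defensive.

Local Open Scope ring_scope.
Local Open Scope complex_scope.

(** * Quads and orientation *)

(** The value of [quad] without [inord], which does not reduce; finite checks over the four vertices
    compute with it. *)
Definition quadn (u v : nat) : nat :=
  if u == 0 :> nat then v.-1 else if v == 0 :> nat then u.-1 else (5 - u - v)%N.

Lemma all_ord4_3 (P : nat -> nat -> nat -> bool) :
  all (fun a => all (fun b => all (P a b) (iota 0 4)) (iota 0 4)) (iota 0 4) ->
  forall a b c : 'I_4, P a b c.
Proof.
move=> /allP h a b c; have mem4 (i : 'I_4) : (i : nat) \in iota 0 4.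
  by rewrite mem_iota /= add0n.
by have /allP/(_ b (mem4 b))/allP/(_ c (mem4 c)) := h a (mem4 a).
Qed.

Lemma all_ord4_5 (P : nat -> nat -> nat -> nat -> nat -> bool) :
  all (fun a => all (fun b => all (fun c => all (fun d => all (P a b c d) (iota 0 4))
    (iota 0 4)) (iota 0 4)) (iota 0 4)) (iota 0 4) ->
  forall a b c d e : 'I_4, P a b c d e.
Proof.
move=> /allP h a b; have mem4 (i : 'I_4) : (i : nat) \in iota 0 4.
  by rewrite mem_iota /= add0n.
by have /allP/(_ b (mem4 b))/all_ord4_3 := h a (mem4 a).
Qed.

Lemma val_quad (u v : 'I_4) : u != v -> quad u v = quadn u v :> nat.
Proof.
move=> ne; rewrite /quad /= inordK ?/quadn //; move: u v ne; clear.
by do 2 case=> [[|[|[|[|?]]]] ?] //.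
Qed.

Lemma quadC (u v : 'I_4) : quad u v = quad v u.
Proof.
have [->//|ne] := eqVneq u v.
apply: val_inj; rewrite /= !val_quad // 1?eq_sym //; clear ne.
by move: u v; do 2 case=> [[|[|[|[|?]]]] ?] //.
Qed.

Lemma uniq_val (n : nat) (s : seq 'I_n) : uniq s -> uniq (map val s).
Proof. by rewrite map_inj_uniq //; apply: val_inj. Qed.

Lemma quad_opp (f g u v : 'I_4) : uniq [:: f; g; u; v] -> quad f g = quad u v.
Proof.
move=> h; apply: val_inj; rewrite /= !val_quad; last 2 first.
- by move: h; rewrite /= !inE andbT => /and3P[].
- by move: h; rewrite /= !inE !negb_or => /andP[/andP[]].
move/uniq_val: h; move: f g u v.
by do 4 case=> [[|[|[|[|?]]]] ?] //.
Qed.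

(** [g] follows [f] counterclockwise around the link of [v]. *)
Definition ccw (v f g : 'I_4) : bool := quad v g == quad v f + 1.

Definition ccwn (v f g : nat) : bool := quadn v g == ((quadn v f).+1 %% 3)%N.

Lemma ccwE (v f g : 'I_4) : uniq [:: v; f; g] -> ccw v f g = ccwn v f g.
Proof.
move=> /=; rewrite !inE negb_or andbT => /andP[/andP[vf vg] fg].
by rewrite /ccw /ccwn -val_eqE /= -!val_quad //= addn1.
Qed.

Lemma ccw_swap (v f g : 'I_4) : uniq [:: v; f; g] -> ccw v g f = ~~ ccw v f g.
Proof.
move=> u; rewrite !ccwE //; last first.
  by move: u; rewrite /= !inE !negb_or !andbT (eq_sym f g) => /andP[/andP[-> ->] ->].
move/uniq_val: u => u.
by have /implyP/(_ u)/eqP := @all_ord4_3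
  (fun v f g => uniq [:: v; f; g] ==> (ccwn v g f == ~~ ccwn v f g)) erefl v f g.
Qed.

(** The transposition of [u] and [v] is odd. This tells apart the two ends of an edge once a walk
    around it has closed up. *)
Lemma ccw_opp (u v f g : 'I_4) : uniq [:: u; v; f; g] -> ccw v f g = ~~ ccw u f g.
Proof.
move=> h; rewrite !ccwE; last 2 first.
- by move: h; rewrite /= !inE !negb_or => /andP[/and3P[_ -> ->] /andP[_ ->]].
- by move: h; rewrite cons_uniq => /andP[].
move/uniq_val: h; move: f g u v.
by do 4 case=> [[|[|[|[|?]]]] ?] //.
Qed.

Definition tpermn (x y z : nat) : nat := if z == x then y else if z == y then x else z.

Lemma val_tperm (x y z : 'I_4) : tperm x y z = tpermn x y z :> nat.
Proof. rewrite /tpermn !val_eqE.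
by case: tpermP => [->|->|/eqP/negbTE-> /eqP/negbTE->]; rewrite ?eqxx //; case: eqP => // ->. Qed.

(** Transpositions generate the permutations, and for one of them the claim is a finite check.
    Gluings, being odd, reverse cyclic orders. *)
Lemma ccw_perm (s : {perm 'I_4}) (v f g : 'I_4) : uniq [:: v; f; g] ->
  ccw (s v) (s f) (s g) = ccw v f g (+) odd_perm s.
Proof.
have ups (p : {perm 'I_4}) (x y z : 'I_4) : uniq [:: x; y; z] -> uniq [:: p x; p y; p z].
  by move=> h; rewrite (map_inj_uniq perm_inj [:: x; y; z]).
have [ts -> dts] := prod_tpermP s.
elim: ts dts v f g => [|[x y] ts IH].
  by move=> _ v f g _; rewrite big_nil !perm1 odd_perm1 addbF.
move=> /andP[xy dts] v f g h; rewrite /= in xy.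
rewrite big_cons !permM IH //; last exact: ups.
rewrite odd_permM odd_tperm xy addbA; congr (_ (+) _).
  rewrite !ccwE //; last exact: ups.
move/uniq_val: h => h; rewrite !val_tperm addbT.
have := @all_ord4_5 (fun x y v f g => (x != y) && uniq [:: v; f; g] ==>
  (ccwn (tpermn x y v) (tpermn x y f) (tpermn x y g) == ~~ ccwn v f g)) erefl x y v f g.
by rewrite val_eqE xy => /implyP/(_ h)/eqP.
Qed.

(** * Turning around edges *)

Lemma exists_complement (u v : 'I_4) : u != v -> exists f g, uniq [:: f; g; u; v].
Proof.
move=> uv; have : #|~: [set u; v]| == 2.
  by have := cardsC [set u; v]; rewrite cards2 uv card_ord; lia.
case/cards2P => f [g [fg E]]; exists f, g.
have : f \in ~: [set u; v] by rewrite E !inE eqxx.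
have : g \in ~: [set u; v] by rewrite E !inE eqxx orbT.
by rewrite !inE !negb_or /= !inE !negb_or fg uv => /andP[-> ->] /andP[-> ->].
Qed.

Lemma complementE (f g u v : 'I_4) : uniq [:: f; g; u; v] ->
  [set f; g] = ~: [set u; v].
Proof.
rewrite /= !inE !negb_or => /and4P[/and3P[fg fu fv] /andP[gu gv] uv _].
apply/eqP; rewrite eqEcard; apply/andP; split.
  by apply/fintype.subsetP => x; rewrite !inE negb_or => /orP[] /eqP ->; rewrite ?fu ?fv ?gu ?gv.
by have := cardsC [set u; v]; rewrite !cards2 fg uv card_ord => /addnI ->.
Qed.

Lemma complement_unique (f g f' g' u v : 'I_4) :
  uniq [:: f; g; u; v] -> uniq [:: f'; g'; u; v] ->
  f = f' /\ g = g' \/ f = g' /\ g = f'.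
Proof.
move=> h h'; have E : [set f; g] = [set f'; g'] by rewrite (complementE h) (complementE h').
have fg : f != g by move: h; rewrite /= !inE !negb_or => /andP[/andP[]].
have : f \in [set f'; g'] by rewrite -E !inE eqxx.
have : g \in [set f'; g'] by rewrite -E !inE eqxx orbT.
rewrite !inE => /orP[]/eqP eg /orP[]/eqP ef; [|by right|by left|];
  by move: fg; rewrite ef eg eqxx.
Qed.

Section Turn.
Variables (D : eqType) (T : gluing D).
Implicit Types (s t : D * 'I_4 * 'I_4) (x y : tedge D).

(** These properties are stated apart from [oriented_gluing], whose carrier is finite, so that they
    also make sense for the infinite cyclic cover. *)
Definition involutive_gluing :=
  forall j f, T (T j f).1 ((T j f).2 f) = (j, (T j f).2^-1%g).

Definition fixfree_gluing := forall j f, ((T j f).1, (T j f).2 f) <> (j, f).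

Definition turn_periodic := forall s, exists m, iter m.+1 (turn T) s = s.

Definition swap s := (s.1.1, s.2, s.1.2).

(** The state [s] turns around the edge [x], in either of the two directions. *)
Definition over s x := (s.1.1 == x.1) && uniq [:: s.1.2; s.2; x.2.1; x.2.2].

Lemma swapK : involutive swap. Proof. by case=> [[]]. Qed.

Lemma over_swap s x : over (swap s) x = over s x.
Proof.
rewrite /over /=; congr (_ && _); rewrite !inE !negb_or (eq_sym s.2).
by do !case: (_ != _).
Qed.

Lemma over_neq s x : over s x -> x.2.1 != x.2.2.
Proof. by case/andP => _ /=; rewrite !inE => /and4P[]. Qed.

Lemma over_faces s x : over s x -> s.1.2 != s.2.
Proof. by case/andP => _ /=; rewrite !inE !negb_or => /andP[/andP[]]. Qed.

Lemma exists_over x : x.2.1 != x.2.2 -> exists s, over s x.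
Proof. by case/exists_complement => f [g h]; exists (x.1, f, g); rewrite /over eqxx. Qed.

Lemma over_unique s t x : over s x -> over t x -> s = t \/ s = swap t.
Proof.
case: s t => [[j f] g] [[k f'] g'] /andP[/eqP /= -> h] /andP[/eqP /= -> h'].
have [[-> ->]|[-> ->]] := complement_unique h h'; [by left | by right].
Qed.

Lemma over_turn s x : over s x ->
  over (turn T s) ((T x.1 s.2).1, ((T x.1 s.2).2 x.2.1, (T x.1 s.2).2 x.2.2)).
Proof.
case: s x => [[j f] g] [k [u v]] /andP[/eqP /= -> h]; rewrite /over /= eqxx /=.
have: uniq [:: g; f; u; v].
  by have := over_swap (k, g, f) (k, (u, v)); rewrite /over /= eqxx /= => <-.
by rewrite -(map_inj_uniq (@perm_inj _ (T k g).2)).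
Qed.

Lemma edge_eq_turn s x : over s x -> exists2 y, edge_eq T x y & over (turn T s) y.
Proof.
move=> h; eexists; last exact: over_turn h.
apply: rst_step; left; case: s x h => [[j f] g] [k [u v]] /andP[_ h].
by apply: GlueEdge; move: h; rewrite /= !inE !negb_or; case/and3P => _ /andP[].
Qed.

Lemma edge_eq_iter_turn m s x :
  over s x -> exists2 y, edge_eq T x y & over (iter m (turn T) s) y.
Proof.
move=> h; elim: m => [|m [y exy oy]]; first by exists x => //; apply: rst_refl.
by have [z eyz oz] := edge_eq_turn oy; exists z => //; apply: rst_trans exy eyz.
Qed.

Lemma edge_eq_nondeg x y : edge_eq T x y -> (x.2.1 == x.2.2) = (y.2.1 == y.2.2).
Proof.
elim=> {x y} [x y|x|x y _ ->|x y z _ -> _ ->] //.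
case=> [[j f u v fu fv]|->] /=; last by rewrite eq_sym.
by rewrite (inj_eq perm_inj).
Qed.

Hypothesis Tinv : involutive_gluing.

(** Swapping reverses the direction of turning, so it conjugates [turn] to its inverse. *)
Lemma turn_swapK s : turn T (swap (turn T s)) = swap s.
Proof. by case: s => [[j f] g]; rewrite /swap /= Tinv /= !permK. Qed.

Lemma turn_inj : injective (turn T).
Proof.
move=> s t e; apply: (can_inj swapK).
by rewrite -[LHS]turn_swapK e turn_swapK.
Qed.

Lemma iter_turn_inj m : injective (iter m (turn T)).
Proof. by elim: m => [|m IH] s t //= /turn_inj/IH. Qed.

Lemma iter_turn_swapK m s : iter m (turn T) (swap (iter m (turn T) s)) = swap s.
Proof. by elim: m => //= m IH; rewrite -iterS iterSr turn_swapK. Qed.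

Lemma turn_faces m s : s.1.2 != s.2 -> (iter m (turn T) s).1.2 != (iter m (turn T) s).2.
Proof.
move=> h; elim: m => //= m; case: (iter m _ s) => [[j f] g] /=.
by rewrite (inj_eq perm_inj) eq_sym.
Qed.

(** As [swap] reverses the orbits of [turn], halfway between a state and its swap
    there would be a state equal to its swap or a face glued to itself. *)
Lemma turn_neq_swap m s : fixfree_gluing -> s.1.2 != s.2 -> iter m (turn T) s <> swap s.
Proof.
move=> ff h; rewrite -[m]odd_double_half -addnn; set i := m./2 => e.
have h' := @turn_faces i s h.
have e' := iter_turn_swapK i s.
case: (odd m) e => /=; rewrite add0n ?iterD.
  rewrite -e' -iterS iterSr => /iter_turn_inj; move: h'.
  case: (iter i _ s) => [[j f] g] _; rewrite /swap /= => -[e1 e2 e3].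
  by apply: (ff j g); rewrite e1 e2.
rewrite -e' => /iter_turn_inj; move: h'.
by case: (iter i _ s) => [[j f] g] /=; rewrite /swap /= => /eqP n [].
Qed.

Hypothesis Tper : turn_periodic.

Lemma iter_turn_inv m s : exists k, iter k (turn T) (iter m (turn T) s) = s.
Proof.
(* As [M.+1] turns fix [s], another [M * m] turns complete [m] turns to [M.+1 * m]. *)
have [M e] := Tper s; exists (M * m)%N; rewrite -iterD -[X in (_ + X)%N]mul1n -mulnDl addn1.
by elim: m => [|m IH]; rewrite ?muln0 // mulnS iterD IH.
Qed.

Definition turn_conn s t := exists m, iter m (turn T) s = t \/ iter m (turn T) s = swap t.

Lemma turn_conn_refl s : turn_conn s s. Proof. by exists 0%N; left. Qed.

Lemma turn_conn_swap s : turn_conn s (swap s).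
Proof. by exists 0%N; right; rewrite swapK. Qed.

Lemma turn_conn_sym s t : turn_conn s t -> turn_conn t s.
Proof.
case=> m [<-|e].
  by have [k e] := iter_turn_inv m s; exists k; left.
by exists m; right; rewrite -(iter_turn_swapK m s) e swapK.
Qed.

Lemma iter_swap m s : exists k, iter k (turn T) (swap s) = swap (iter m (turn T) s).
Proof.
have [k e] := iter_turn_inv m (swap (iter m (turn T) s)).
by exists k; rewrite -{1}(iter_turn_swapK m s).
Qed.

Lemma turn_conn_trans s t r : turn_conn s t -> turn_conn t r -> turn_conn s r.
Proof.
case=> m em [k ek].
case: em => em.
  by exists (k + m)%N; rewrite iterD em.
have [k' e'] := iter_swap k t; exists (k' + m)%N; rewrite iterD em e'.
by case: ek => ->; rewrite ?swapK; [right|left].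
Qed.

(** Each elementary identification of edges is one turn, in a suitable direction. Edge classes are
    therefore orbits of [turn], up to [swap]. *)
Lemma edge_eq_turn_conn x y s t :
  edge_eq T x y -> over s x -> over t y -> turn_conn s t.
Proof.
have same r r' z : over r z -> over r' z -> turn_conn r r'.
  by move=> o o'; case: (over_unique o o') => ->; [apply: turn_conn_refl|
    apply: turn_conn_sym; apply: turn_conn_swap].
move=> e; elim: e s t => {x y} [x y h|x|x y _ IH|x y z e IH _ IH'] s t os ot.
- case: h => [h|e]; last first.
    apply: same os _; move: ot; rewrite e /over /= !inE !negb_or (eq_sym x.2.2 x.2.1).
    by do !case: (_ != _); do ?case: (_ == _).
  case: h os ot => j f u v fu fv os ot.
  (* Of the two states over the edge, [r] is the one leaving through the face [f] of the gluing. *)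
  have [r [sr or rf]] : exists r, [/\ turn_conn s r, over r (j, (u, v)) & r.2 = f].
    have [e|n1] := eqVneq s.2 f; first by exists s; split => //; apply: turn_conn_refl.
    exists (swap s); rewrite over_swap; split => //; first exact: turn_conn_swap.
    have : f \in [set s.1.2; s.2].
      by case/andP: os => _ /complementE ->; rewrite !inE negb_or fu fv.
    by rewrite !inE => /orP[]/eqP fE //; move: n1; rewrite fE eqxx.
  apply: (turn_conn_trans sr); apply: (@turn_conn_trans _ (turn T r)); first by exists 1%N; left.
  by apply: same ot; have := over_turn or; rewrite rf.
- exact: same os ot.
- by apply: turn_conn_sym; apply: IH.
- have /exists_over[r or] : y.2.1 != y.2.2 by rewrite -(edge_eq_nondeg e); apply: over_neq os.
  by apply: (@turn_conn_trans _ r); [apply: IH|apply: IH'].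
Qed.

End Turn.

(** * Sums around edges *)

Section OrbitSum.
Variables (D : finType) (T : gluing D).
Hypothesis oT : oriented_gluing T.

Lemma oriented_involutive : involutive_gluing T.
Proof. by move=> j f; case: (oT j f). Qed.

Lemma oriented_fixfree : fixfree_gluing T.
Proof. by move=> j f; case: (oT j f) => _ _ /eqP. Qed.

Let tinj := turn_inj oriented_involutive.

Lemma finite_turn_periodic : turn_periodic T.
Proof.
move=> s; exists (fingraph.order (turn T) s).-1.
by rewrite prednK ?order_gt0 // (fingraph.iter_order tinj).
Qed.

(** The row of the edge [x] of the gluing matrices, applied to [F]; quads are absolute here, not
    relative to a chosen quad type. *)
Definition edge_sum (V : zmodType) (F : D -> 'I_3 -> V) (x : tedge D) : V :=
  \sum_j \sum_k F j k *+ nedges T j k x.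

(** The edge turned around is opposite to the one joining the vertices [t.1.2] and [t.2], hence has
    the same quad. *)
Definition turn_value (V : zmodType) (F : D -> 'I_3 -> V) (t : D * 'I_4 * 'I_4) : V :=
  F t.1.1 (quad t.1.2 t.2).

Lemma edge_sumE (V : zmodType) (F : D -> 'I_3 -> V) (x : tedge D) :
  edge_sum F x = \sum_(y : tedge D | (y.2.1 < y.2.2)%N && `[< edge_eq T y x >])
                   F y.1 (quad y.2.1 y.2.2).
Proof.
rewrite /edge_sum (eq_bigr (fun j => \sum_(uv : 'I_4 * 'I_4 |
   (uv.1 < uv.2)%N && `[< edge_eq T (j, uv) x >]) F j (quad uv.1 uv.2))).
  by rewrite pair_big_dep /=; apply: eq_big => -[].
move=> j _; rewrite [RHS](partition_big (fun uv => quad uv.1 uv.2) xpredT) //=.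
apply: eq_bigr => k _; rewrite /nedges -sum1_card -sumrMnr.
apply: eq_big => [uv|uv]; last by rewrite inE => /and3P[_ /eqP -> _]; rewrite mulr1n.
by rewrite inE -andbA; congr (_ && _); rewrite andbC.
Qed.

Lemma sorted_over_unique t (y y' : tedge D) : (y.2.1 < y.2.2)%N -> (y'.2.1 < y'.2.2)%N ->
  over t y -> over t y' -> y = y'.
Proof.
case: y y' => [j [u v]] [k [u' v']] /= lt lt'; rewrite /over /=.
move=> /andP[/eqP <- h] /andP[/eqP <- h']; congr (_, _).
have h1 (a b c d : 'I_4) : uniq [:: a; b; c; d] -> uniq [:: c; d; a; b].
  rewrite /= !inE !negb_or (eq_sym a c) (eq_sym a d) (eq_sym b c) (eq_sym b d).
  by do !case: (_ != _).
have [[-> ->]//|[e1 e2]] := complement_unique (h1 _ _ _ _ h) (h1 _ _ _ _ h').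
by move: lt lt'; rewrite e1 e2 => /ltnW; rewrite leqNgt => /negbTE ->.
Qed.

(** Double counting of states and edges: an edge in the class of [x] has one of its two states in
    the orbit by [edge_eq_turn_conn], and not both by [turn_neq_swap]. *)
Lemma orbit_sum (V : zmodType) (F : D -> 'I_3 -> V) s x : over s x ->
  \sum_(t <- fingraph.orbit (turn T) s) turn_value F t = edge_sum F x.
Proof.
move=> osx; rewrite edge_sumE.
have edgeP t : t \in fingraph.orbit (turn T) s ->
    exists y : tedge D, [/\ (y.2.1 < y.2.2)%N, over t y & edge_eq T y x].
  rewrite -fconnect_orbit => /iter_findex <-.
  have [y exy oy] := edge_eq_iter_turn T (findex (turn T) s t) osx.
  have : y.2.1 != y.2.2 by rewrite -(edge_eq_nondeg exy); apply: over_neq osx.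
  rewrite neq_ltn => /orP[lt|lt].
    by exists y; split => //; apply: rst_sym.
  exists (y.1, (y.2.2, y.2.1)); split => //=.
    move: oy; rewrite /over /= !inE !negb_or (eq_sym y.2.2 y.2.1).
    by do !case: (_ != _); do ?case: (_ == _).
  by apply: rst_sym; apply: rst_trans exy _; apply: rst_step; right.
rewrite big_uniq ?fingraph.orbit_uniq //=.
transitivity (\sum_(t in fingraph.orbit (turn T) s)
    \sum_(y : tedge D | (y.2.1 < y.2.2)%N && over t y) F y.1 (quad y.2.1 y.2.2)).
  apply: eq_bigr => t /edgeP[y [lt oy _]].
  rewrite (big_pred1 y).
    by rewrite /turn_value; case/andP: oy => /eqP -> /quad_opp ->.
  move=> y'; rewrite /=; apply/andP/eqP => [[lt' oy']|-> //].
  apply: sorted_over_unique lt' lt oy' oy.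
rewrite (exchange_big_dep (fun y : tedge D => (y.2.1 < y.2.2)%N && `[< edge_eq T y x >])) /=.
  apply: eq_bigr => y /andP[lt /asboolP eyx].
  have ne : y.2.1 != y.2.2 by rewrite neq_ltn lt.
  have [t0 ot0] := exists_over ne.
  have [t [ot tin]] : exists t, over t y /\ t \in fingraph.orbit (turn T) s.
    have exy : edge_eq T x y by apply: rst_sym.
    have [m [e|e]] := edge_eq_turn_conn oriented_involutive finite_turn_periodic exy osx ot0.
      by exists t0; split=> //; rewrite -fconnect_orbit -e; exact: fconnect_iter.
    by exists (swap t0); split; rewrite ?over_swap // -fconnect_orbit -e; exact: fconnect_iter.
  rewrite (big_pred1 t) // => t'; rewrite lt /=; apply/andP/eqP => [[t'in ot']|->//].
  have [//|e] := over_unique ot' ot; exfalso.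
  move: t'in tin; rewrite -!fconnect_orbit => t'in tin.
  have : fconnect (turn T) t t'.
    by rewrite (fconnect_sym tinj); apply: connect_trans tin; rewrite (fconnect_sym tinj).
  move/iter_findex; rewrite e; apply: (turn_neq_swap oriented_involutive oriented_fixfree).
  exact: over_faces ot.
move=> t y /edgeP[y' [lt' oy' ey']] /andP[lt oy]; rewrite lt /=; apply/asboolP.
by rewrite (sorted_over_unique lt lt' oy oy').
Qed.

(** A closed sequence of turns runs a whole number of times through the orbit, whose sum is an edge
    sum. *)
Lemma edge_loop_sum (V : zmodType) (F : D -> 'I_3 -> V) s m :
  (forall x : tedge D, x.2.1 != x.2.2 -> edge_sum F x = 0) ->
  s.1.2 != s.2 -> iter m (turn T) s = s ->
  \sum_(t <- traject (turn T) s m) turn_value F t = 0.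
Proof.
move=> F0 ne; case: m => [|m] e; first by rewrite big_nil.
have cyc : fcycle (turn T) (traject (turn T) s m.+1).
  by rewrite /= -[X in rcons _ X]e iterSr -trajectSr fpath_traject.
have [k ck] := fcycle_consEflatten cyc; rewrite trajectS ck; clear ck.
have : \sum_(t <- fingraph.orbit (turn T) s) turn_value F t = 0.
  have [f [g h]] := exists_complement ne.
  have os : over s (s.1.1, (f, g)).
    rewrite /over eqxx /=; move: h; rewrite /= !inE !negb_or.
    rewrite (eq_sym f s.1.2) (eq_sym f s.2) (eq_sym g s.1.2) (eq_sym g s.2).
    by do !case: (_ != _).
  by rewrite (orbit_sum F os) F0 //; apply: over_neq os.
by elim: k.+1 => [|k' IH] h /=; rewrite ?big_nil // big_cat /= h IH // addr0.
Qed.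

End OrbitSum.

(** * Potentials *)

Section Potential.
Variables (X Y : Type) (V : zmodType).
Variables (step : X -> Y -> X) (ok : X -> Y -> bool) (c : X -> Y -> V).

Fixpoint path_ok x w := if w is y :: w' then ok x y && path_ok (step x y) w' else true.

Fixpoint path_sum x w := if w is y :: w' then c x y + path_sum (step x y) w' else 0.

Lemma path_ok_cat x w1 w2 :
  path_ok x (w1 ++ w2) = path_ok x w1 && path_ok (foldl step x w1) w2.
Proof. by elim: w1 x => //= y w1 IH x; rewrite IH andbA. Qed.

Lemma path_sum_cat x w1 w2 :
  path_sum x (w1 ++ w2) = path_sum x w1 + path_sum (foldl step x w1) w2.
Proof. by elim: w1 x => [|y w1 IH] x /=; rewrite ?add0r // IH addrA. Qed.

Lemma path_sumE y0 x w : path_sum x w =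
  \sum_(i < size w) c (foldl step x (take i w)) (nth y0 w i).
Proof.
elim: w x => [|y w IH] x /=; first by rewrite big_ord0.
by rewrite big_ord_recl /= IH.
Qed.

Hypothesis reversible : forall x y, ok x y ->
  exists y', [/\ ok (step x y) y', step (step x y) y' = x & c (step x y) y' = - c x y].

Lemma path_reverse x w : path_ok x w -> exists w',
  [/\ path_ok (foldl step x w) w', foldl step (foldl step x w) w' = x
    & path_sum (foldl step x w) w' = - path_sum x w].
Proof.
elim: w x => [|y w IH] x /=; first by exists [::]; rewrite /= oppr0.
case/andP => /reversible[y' [ky sy cy]] /IH[w' [kw sw cw]].
exists (w' ++ [:: y']); rewrite path_ok_cat foldl_cat path_sum_cat sw /= sy cy cw kw ky.
by rewrite addr0 opprD addrC.
Qed.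

Hypothesis closed_path_sum : forall x w, path_ok x w -> foldl step x w = x -> path_sum x w = 0.

Lemma path_sum_unique x w1 w2 : path_ok x w1 -> path_ok x w2 ->
  foldl step x w1 = foldl step x w2 -> path_sum x w1 = path_sum x w2.
Proof.
move=> o1 o2 e; have [w' [kw sw cw]] := path_reverse o2.
have := @closed_path_sum x (w1 ++ w').
rewrite path_ok_cat o1 foldl_cat path_sum_cat e kw sw cw => /(_ isT erefl) /eqP.
by rewrite subr_eq0 => /eqP.
Qed.

Let conn x y := exists2 w, path_ok x w & foldl step x w = y.

Let conn_refl x : conn x x. Proof. by exists [::]. Qed.

Let conn_trans x y z : conn x y -> conn y z -> conn x z.
Proof.
move=> [w1 o1 e1] [w2 o2 e2]; exists (w1 ++ w2).
  by rewrite path_ok_cat o1 e1.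
by rewrite foldl_cat e1.
Qed.

Let conn_sym x y : conn x y -> conn y x.
Proof. by move=> [w o <-]; have [w' [? ? _]] := path_reverse o; exists w'. Qed.

(** [P] selects the admissible values of the potential in each component. *)
Lemma potential (P : X -> V -> Prop) :
  (forall x, exists v, P x v) ->
  (forall x y v, ok x y -> P x v -> P (step x y) (v + c x y)) ->
  exists g : X -> V, (forall x, P x (g x)) /\
    forall x y, ok x y -> g (step x y) = g x + c x y.
Proof.
move=> P0 PS.
(* The representative is chosen from the connected component as a set, so that connected points get
   equal roots. *)
have [rt rtP] := @choice {A : X -> Prop | exists x, A x} X (fun A x => sval A x)
  (fun A => proj2_sig A).
pose root x := rt (exist _ (conn x) (ex_intro _ x (conn_refl x))).
have rootP x : conn (root x) x by apply: conn_sym; apply: (rtP (exist _ (conn x) _)).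
have root_eq x y : conn x y -> root x = root y.
  move=> xy; rewrite /root; congr rt; apply: eq_exist.
  apply/funext => z; apply/propext; split => h; last exact: conn_trans xy h.
  by apply: conn_trans h; apply: conn_sym.
have [v0 v0P] := choice P0.
have [w wP] := @choice X (seq Y)
  (fun x w => path_ok (root x) w /\ foldl step (root x) w = x)
  (fun x => let: ex_intro2 w kw ew := rootP x in ex_intro _ w (conj kw ew)).
exists (fun x => v0 (root x) + path_sum (root x) (w x)); split => [x|x y oxy].
  have [kw ew] := wP x; rewrite -{1}ew; move: (v0P (root x)) kw.
  elim: (w x) (root x) (v0 _) => [|y w' IH] z v Pv /=; first by rewrite addr0.
  by case/andP => oz /IH h; rewrite addrA; apply: h; apply: PS.
have e : root (step x y) = root x.
  by symmetry; apply: root_eq; exists [:: y]; rewrite /= ?oxy.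
rewrite e -addrA; congr (_ + _).
have [kw ew] := wP x; have := wP (step x y); rewrite e => -[kw' ew'].
rewrite (@path_sum_unique _ _ (w x ++ [:: y])) //; last 2 first.
- by rewrite path_ok_cat kw ew /= oxy.
- by rewrite foldl_cat ew' ew.
by rewrite path_sum_cat ew /= addr0.
Qed.

End Potential.

(** * Vertex links *)

(** The edge [f g] is opposite to the one joining [v] to the fourth vertex, so its quad is the third
    one around the link of [v]. *)
Lemma quad_third (v f g : 'I_4) : uniq [:: v; f; g] ->
  if ccw v f g then quad v g = quad v f + 1 /\ quad f g = quad v f - 1
  else quad v g = quad v f - 1 /\ quad f g = quad v f + 1.
Proof.
move=> h; rewrite ccwE //.
have [vf vg fg] : [/\ v != f, v != g & f != g].
  by move: h; rewrite /= !inE !negb_or andbT => /andP[/andP[-> ->] ->].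
have : if ccwn v f g then quadn v g = ((quadn v f + 1) %% 3)%N /\ quadn f g = ((quadn v f + 2) %% 3)%N
       else quadn v g = ((quadn v f + 2) %% 3)%N /\ quadn f g = ((quadn v f + 1) %% 3)%N.
  clear vf vg fg; move/uniq_val: h; move: v f g.
  by do 3 case=> [[|[|[|[|?]]]] ?] //.
by case: ifP => _ [e1 e2]; split; apply: val_inj; rewrite /= !val_quad //.
Qed.

Lemma sum_I3 (V : zmodType) (F : 'I_3 -> V) : \sum_k F k = F 0 + F 1 + F (-1).
Proof.
rewrite !big_ord_recr big_ord0 /= add0r; congr (_ + _ + _); congr F; exact: val_inj.
Qed.

Section Link.
Variables (R : realType) (D : finType) (T : gluing D).
Local Notation C := R[i].
Variable U : D -> 'I_3 -> C.
Hypothesis oT : oriented_gluing T.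
Hypothesis Usum : forall j, \sum_k U j k = 0.
Hypothesis Uedge : forall x : tedge D, x.2.1 != x.2.2 -> edge_sum T U x = 0.
Hypothesis Ucurve : forall m (c : 'I_m.+1 -> arc D), peripheral_curve T R c ->
  \sum_i (arc_sign (c i))%:~R * U (c i).1.1 (arc_quad (c i)) = 0.

Let Tinv := oriented_involutive oT.

(** Vanishing of the sum of the three values makes the corner values [U] of a
    triangle the differences of these side values. *)
Definition side_value (j : D) (k : 'I_3) : C := (U j (k - 1) - U j (k + 1)) / 3.

Lemma Usum3 j k : U j k + U j (k + 1) + U j (k - 1) = 0.
Proof. by rewrite -(Usum j) (reindex_inj (addrI k)) sum_I3 addr0. Qed.

(** An arc from the side [f] to the side [g] cuts off a corner of quad [quad f g]; its signed
    contribution to a curve becomes a difference of values on the two sides. *)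
Lemma side_valueB (j : D) (v f g : 'I_4) : uniq [:: v; f; g] ->
  side_value j (quad v g) - side_value j (quad v f) =
  (if ccw v f g then -1 else 1) * U j (quad f g).
Proof.
move/quad_third; rewrite /side_value; set k := quad v f; have := Usum3 j k.
have e1 : k + 1 + 1 = k - 1 by rewrite -addrA; congr (_ + _); apply: val_inj.
have e2 : k - 1 - 1 = k + 1 by rewrite -addrA; congr (_ + _); apply: val_inj.
move=> e; have e3 : U j k = - (U j (k + 1) + U j (k - 1)).
  by apply/eqP; rewrite -addr_eq0 addrA e.
by case: ifP => _ [-> ->]; rewrite ?e1 ?e2 ?addrK ?subrK e3; field.
Qed.

Lemma sum_side_value j : \sum_k side_value j k = 0.
Proof.
rewrite sum_I3 /side_value sub0r add0r subrr addNr.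
have -> : 1 + 1 = -1 :> 'I_3 by apply: val_inj.
have -> : -1 - 1 = 1 :> 'I_3 by apply: val_inj.
by field.
Qed.

Lemma side_value_diff j k : side_value j (k + 1) - side_value j (k - 1) = U j k.
Proof.
have e1 : k + 1 + 1 = k - 1 by rewrite -addrA; congr (_ + _); apply: val_inj.
have e2 : k - 1 - 1 = k + 1 by rewrite -addrA; congr (_ + _); apply: val_inj.
have := Usum3 j k; rewrite /side_value e1 e2 addrK subrK => e.
have -> : U j (k - 1) = - (U j k + U j (k + 1)).
  by apply/eqP; rewrite -addr_eq0 addrC e.
by field.
Qed.

Definition link_step (y : D * 'I_4) (f : 'I_4) : D * 'I_4 :=
  ((T y.1 f).1, (T y.1 f).2 y.2).

Definition link_ok (y : D * 'I_4) (f : 'I_4) := f != y.2.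

(** The jump of the side values across the side being crossed. Summation by parts relates its sum
    along a closed walk to the corners cut off. *)
Definition link_weight (y : D * 'I_4) (f : 'I_4) : C :=
  side_value y.1 (quad y.2 f) -
  side_value (T y.1 f).1 (quad ((T y.1 f).2 y.2) ((T y.1 f).2 f)).

Local Notation link_walk := (foldl link_step).
Local Notation link_sum := (path_sum link_step link_weight).

Definition link_state (y : D * 'I_4) : D * option 'I_4 := (y.1, Some y.2).

Lemma walk_link y w : walk T (link_state y) w = link_state (link_walk y w).
Proof. by elim: w y => //= f w IH y; rewrite -IH. Qed.

Lemma link_stepK y f : link_step (link_step y f) ((T y.1 f).2 f) = y.
Proof. by rewrite /link_step /= Tinv /= permK; case: y. Qed.

Lemma link_weightK y f :
  link_weight (link_step y f) ((T y.1 f).2 f) = - link_weight y f.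
Proof. by rewrite /link_weight /link_step /= Tinv /= !permK opprB. Qed.

Lemma link_reversible y f : link_ok y f -> exists f',
  [/\ link_ok (link_step y f) f', link_step (link_step y f) f' = y
    & link_weight (link_step y f) f' = - link_weight y f].
Proof.
move=> h; exists ((T y.1 f).2 f); rewrite link_stepK link_weightK; split => //.
by rewrite /link_ok /= (inj_eq perm_inj).
Qed.

(** A turn exchanges the two faces and an odd gluing reverses the order again, so the orientation
    persists. All corners passed then count with the same sign, and the side values telescope. *)
Lemma link_track m s v : uniq [:: v; s.1.2; s.2] ->
  let w := [seq t.2 | t <- traject (turn T) s m] in
  let s' := iter m (turn T) s in
  exists v', [/\ link_walk (s.1.1, v) w = (s'.1.1, v'), uniq [:: v'; s'.1.2; s'.2],
    ccw v' s'.1.2 s'.2 = ccw v s.1.2 s.2 &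
    link_sum (s.1.1, v) w = (if ccw v s.1.2 s.2 then -1 else 1) *
        (\sum_(t <- traject (turn T) s m) turn_value U t)
      + side_value s.1.1 (quad v s.1.2) - side_value s'.1.1 (quad v' s'.1.2)].
Proof.
elim: m s v => [|m IH] s v h /=.
  by exists v; split => //; rewrite big_nil mulr0 add0r subrr.
rewrite -iterS iterSr /=.
case: s h => [[j f] g] /= h.
set p := (T j g).2.
have h1 : uniq [:: v; g; f].
  by move: h; rewrite /= !inE !negb_or (eq_sym f g); do !case: (_ != _).
have h2 : uniq [:: p v; p g; p f].
  by rewrite -(map_inj_uniq (@perm_inj _ p)) in h1.
have [v' []] := IH (turn T (j, f, g)) (p v) h2.
have odd_p : odd_perm p by case: (oT j g).
have -> : ccw (p v) (turn T (j, f, g)).1.2 (turn T (j, f, g)).2 = ccw v f g.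
  by rewrite /= ccw_perm // odd_p addbT ccw_swap // negbK.
move=> e1 e2 e3 e4; exists v'; split => //.
rewrite big_cons /= in e4 *; rewrite e4.
rewrite /link_weight /= -/p mulrDr {1}/turn_value /= -side_valueB //.
by ring.
Qed.

(** Backtracks cancel, and by [link_track] an edge loop sums to plus or minus a vanishing edge
    sum. *)
Lemma relator_link y r : relator T (link_state y) r ->
  walk T (link_state y) r = link_state y /\ link_sum y r = 0.
Proof.
move E: (link_state y) => x h; rewrite -E walk_link; move: E.
case: h => [j ov f fov|j ov f g m fg fov gov e] [ej ev]; subst j ov.
  rewrite /= -/(link_step y f) link_stepK; split => //.
  by rewrite -/(link_step y f) link_weightK addr0 subrr.
have un : uniq [:: y.2; f; g].
  rewrite /= !inE !negb_or fg !andbT; apply/andP; split.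
    by apply: contraNneq fov => ->.
  by apply: contraNneq gov => ->.
have [v' /=] := @link_track m (y.1, f, g) y.2 un; rewrite e /= => -[ew uv' cv' es].
(* The walk returns to the same tetrahedron and faces, so [v'] is an end of the edge turned around;
   the other end would see the faces in the opposite order. *)
have ev : v' = y.2.
  have [//|ne] := eqVneq v' y.2.
  have := @ccw_opp v' y.2 f g; rewrite cons_uniq un !inE negb_or andbT.
  have -> : (v' != y.2) && ~~ ((v' == f) || (v' == g)).
    by move: uv'; rewrite !inE ne => /andP[].
  by rewrite cv' => /(_ isT); case: (ccw _ _ _).
rewrite ev -!surjective_pairing in ew es.
by rewrite ew es edge_loop_sum // mulr0 add0r subrr.
Qed.

Lemma homotopic_link_sum y w w' :
  homotopic T (link_state y) w w' -> link_sum y w = link_sum y w'.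
Proof.
elim=> {w w'} [w w' h|//|w w' _ -> //|w1 w2 w3 _ -> _ -> //].
case: h => w1 r w2; rewrite walk_link => h.
have [ew es] := relator_link h.
move: ew; rewrite walk_link => -[e1 e2].
have ew : link_walk (link_walk y w1) r = link_walk y w1.
  by rewrite [LHS]surjective_pairing e1 e2 -surjective_pairing.
by rewrite !path_sum_cat es add0r ew.
Qed.

Section SimpleClosedWalk.
Variables (y : D * 'I_4) (m : nat) (w : seq 'I_4).
Hypotheses (sz : size w = m.+1) (okw : path_ok link_step link_ok y w).
Hypothesis (closed : link_walk y w = y).

Let st (i : nat) := link_walk y (take i w).
Let wd (i : nat) := nth ord0 w i.
Let enter (i : 'I_m.+1) := (T (st (ord_pred i)).1 (wd (ord_pred i))).2 (wd (ord_pred i)).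

Definition walk_curve (i : 'I_m.+1) : arc D := (st i, (enter i, wd i)).

Let st_next (i : 'I_m.+1) : st (ordS i) = link_step (st i) (wd i).
Proof.
have lt : (i < size w)%N by rewrite sz.
have e : link_step (st i) (wd i) = st i.+1.
  by rewrite /st (take_nth ord0 lt) -cats1 foldl_cat.
rewrite e /=; have := ltn_ord i; rewrite leq_eqVlt => /orP[/eqP ->|lt'].
  by rewrite modnn /st take0 -sz take_size closed.
by rewrite modn_small.
Qed.

Let ok_at (i : 'I_m.+1) : link_ok (st i) (wd i).
Proof.
have lt : (i < size w)%N by rewrite sz.
by move: okw; rewrite -(cat_take_drop i w) (drop_nth ord0 lt) path_ok_cat => /and3P[].
Qed.

Let enter_ok (i : 'I_m.+1) : enter i != (st i).2.
Proof.
rewrite -{2}(ord_predK i) st_next /= (inj_eq perm_inj); exact: ok_at.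
Qed.

(** Leaving through the entrance leads back to the preceding triangle. With no triangle repeated,
    the whole walk consists of these two cancelling steps. *)
Lemma closed_walk_sum_backtrack (i : 'I_m.+1) :
  (forall i k : 'I_m.+1, st i = st k -> i = k) ->
  enter i = wd i -> link_sum y w = 0.
Proof.
move=> inj e.
have [p pE] : {p | ord_pred i = p} by exists (ord_pred i).
have entE : enter i = (T (st p).1 (wd p)).2 (wd p) by rewrite /enter pE.
have ei : st i = link_step (st p) (wd p) by rewrite -pE -st_next ord_predK.
have ep : ordS i = p by apply: inj; rewrite st_next -e entE ei link_stepK.
(* If both triangles were the same one, a face would be glued to itself. *)
have [ip|np] := eqVneq p i.
  case: (oriented_fixfree oT (j := (st p).1) (f := wd p)).
  by rewrite -entE e ip; congr (_, _); have := congr1 fst ei; rewrite ip.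
rewrite (path_sumE _ _ ord0) sz (bigD1 i) //= (bigD1 p) //=.
rewrite -/(st i) -/(st p) -/(wd i) -/(wd p) -e entE ei link_weightK addrA addNr add0r.
(* Predecessor and successor of [i] agree and differ from [i], so the cycle has length two and there
   is no third index [k]. *)
rewrite big1 // => k /andP[ki kp]; exfalso.
have {pE} pE : ord_pred i = ordS i by rewrite pE ep.
move: ki kp np; rewrite -ep; have := congr1 val pE; rewrite -!val_eqE /=.
have m0 : (0 < m.+1)%N by [].
have := ltn_ord i; have := ltn_ord k.
move: (nat_of_ord i) (nat_of_ord k) => a b lb la.
have -> : ((a + m.+1).-1 %% m.+1 = if a == 0 then m else a.-1)%N.
  case: a la => [|a] la /=; first by rewrite modn_small.
  by rewrite modnDr modn_small // ltnW.
have -> : (a.+1 %% m.+1 = if a == m then 0 else a.+1)%N.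
  have [->|ne] := eqVneq a m; first by rewrite modnn.
  by rewrite modn_small // ltn_neqAle eqSS ne.
by do 2 case: eqVneq => ?; move=> ? /eqP ? /eqP ? /eqP ?; lia.
Qed.

Lemma simple_walk_curve : (forall i k : 'I_m.+1, st i = st k -> i = k) ->
  (forall i, enter i != wd i) ->
  homotopic T (link_state y) w [::] \/ peripheral_curve T R walk_curve.
Proof.
move=> inj ne; have [h|nh] := pselect (homotopic T (link_state y) w [::]); first by left.
right; split.
- move=> i; rewrite /walk_curve st_next /=; case E: (st i) => [j v].
  split => //.
    rewrite /= !inE !negb_or ne andbT.
    have := enter_ok i; have := ok_at i; rewrite /link_ok E /= => h1 h2.
    by rewrite eq_sym h2 eq_sym h1.
  by rewrite /enter ordSK E.
(* Any crossing points would do, as distinct arcs lie in distinct triangles. *)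
- exists (fun _ => 2^-1); first by move=> i; rewrite invr_gt0 ltr0n invf_lt1 ?ltr1n.
  move=> side ent leave i k /eqP ik /= h; case: ik; exact: inj.
- have -> : curve_word walk_curve = w.
    apply: (@eq_from_nth _ ord0); first by rewrite size_map size_enum_ord.
    move=> k; rewrite size_map size_enum_ord => lt.
    by rewrite (nth_map ord0) ?size_enum_ord // /walk_curve /= nth_enum_ord.
  by rewrite /walk_curve /= /st take0.
Qed.

(** Shifting the index by one moves the second half of each jump to the triangle entered. Each
    triangle then carries a difference of side values, which is its signed corner value. *)
Lemma walk_curve_sum : (forall i, enter i != wd i) ->
  \sum_i (arc_sign (walk_curve i))%:~R * U (walk_curve i).1.1 (arc_quad (walk_curve i)) =
  link_sum y w.
Proof.
move=> ne; rewrite (path_sumE _ _ ord0) sz /link_weight sumrB.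
rewrite (eq_bigr (fun i : 'I_m.+1 => side_value (st i).1 (quad (st i).2 (wd i)) -
                           side_value (st i).1 (quad (st i).2 (enter i)))).
  rewrite sumrB; congr (_ - _).
  rewrite (reindex_inj (can_inj (@ordSK m.+1))); apply: eq_bigr => i _.
  by rewrite st_next /enter ordSK.
move=> i _; rewrite side_valueB; last first.
  rewrite /= !inE !negb_or ne andbT.
  have := enter_ok i; have := ok_at i; rewrite /link_ok => h1 h2.
  by rewrite eq_sym h2 eq_sym h1.
by rewrite /arc_sign /arc_quad /= /ccw; case: ifP => _; rewrite ?rmorphN1.
Qed.

End SimpleClosedWalk.

(** A shortest closed walk with nonzero sum visits each triangle at most once, so
    that it is trivially embedded; it is essential because the sum is invariant
    under homotopy. *)
Lemma closed_link_sum y w :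
  path_ok link_step link_ok y w -> link_walk y w = y -> link_sum y w = 0.
Proof.
have [n] := ubnP (size w); elim: n => // n IH in y w *.
rewrite ltnS => szn okw clw.
case sz: (size w) => [|m]; first by rewrite (size0nil sz).
pose sts := mkseq (fun i => link_walk y (take i w)) m.+1.
have [un|] := boolP (uniq sts).
  have inj (i k : 'I_m.+1) : link_walk y (take i w) = link_walk y (take k w) -> i = k.
    move=> e; apply/val_inj/eqP.
    by rewrite -(@nth_uniq _ y sts) ?size_mkseq ?ltn_ord // !nth_mkseq ?ltn_ord //= e.
  have [[i e]|ne] := pselect (exists i : 'I_m.+1, (walk_curve y w i).2.1 = (walk_curve y w i).2.2).
    exact: (@closed_walk_sum_backtrack y m w sz okw clw i inj e).
  have ne' (i : 'I_m.+1) : (walk_curve y w i).2.1 != (walk_curve y w i).2.2.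
    by apply/eqP => e; apply: ne; exists i.
  have [/homotopic_link_sum //|pc] := simple_walk_curve sz okw clw inj ne'.
  by rewrite -(walk_curve_sum sz okw clw ne') Ucurve.
(* A repeated triangle splits the walk into two shorter closed walks. *)
case/(uniqPn y) => i [k []]; rewrite size_mkseq => ik km.
rewrite !nth_mkseq ?(ltn_trans ik km) // => e.
have wE : w = take i w ++ drop i (take k w) ++ drop k w.
  by rewrite catA -{1}(@take_takel _ i k w (ltnW ik)) !cat_take_drop.
have tE : take k w = take i w ++ drop i (take k w).
  by rewrite -{1}(@take_takel _ i k w (ltnW ik)) cat_take_drop.
move: okw clw; rewrite {1 2}wE !path_ok_cat !foldl_cat => /and3P[ok1 ok2 ok3] cl.
have e2 : link_walk (link_walk y (take i w)) (drop i (take k w)) = link_walk y (take i w).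
  by rewrite -foldl_cat -tE.
rewrite e2 in cl ok3.
rewrite wE !path_sum_cat e2 (IH (link_walk y (take i w)) (drop i (take k w))) //.
  rewrite add0r -path_sum_cat IH // ?path_ok_cat ?foldl_cat ?ok1 //.
  by rewrite size_cat size_takel ?size_drop ?sz; lia.
by rewrite size_drop size_takel ?sz; lia.
Qed.

(** [g] is the logarithm of a scale for each corner triangle: the numbers [side_value + g] agree on
    the two triangles sharing a side. *)
Lemma link_potential : exists g : D * 'I_4 -> C, forall j v f, f != v ->
  g ((T j f).1, (T j f).2 v) = g (j, v) + link_weight (j, v) f.
Proof.
have [g [_ gE]] := potential link_reversible closed_link_sum (P := fun _ _ => True)
  (fun _ => ex_intro _ 0 I) (fun _ _ _ _ _ => I).
by exists g => j v f fv; apply: (gE (j, v) f).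
Qed.
End Link.

(** * Edge weights *)

Lemma sum_edges (V : zmodType) (F : 'I_4 -> 'I_4 -> 'I_3 -> V) :
  let o : nat -> 'I_4 := inord in
  \sum_(uv : 'I_4 * 'I_4 | (uv.1 < uv.2)%N) F uv.1 uv.2 (quad uv.1 uv.2) =
  F (o 0) (o 1) 0 + F (o 0) (o 2) 1 + F (o 0) (o 3) (-1)
  + (F (o 1) (o 2) (-1) + F (o 1) (o 3) 1) + F (o 2) (o 3) 0.
Proof.
move=> o; rewrite (eq_bigl (fun uv : 'I_4 * 'I_4 => xpredT uv.1 && (uv.1 < uv.2)%N)) //.
rewrite -(pair_big_dep xpredT (fun u v : 'I_4 => (u < v)%N) (fun u v => F u v (quad u v))) /=.
have qE a b k : (a < b < 4)%N -> quadn a b = k -> quad (o a) (o b) = k :> nat.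
  move=> /andP[ab b4] <-; have a4 := ltn_trans ab b4.
  rewrite val_quad /o ?inordK //.
  by apply/eqP => /(congr1 val); rewrite /= !inordK //; lia.
under eq_bigr do rewrite big_mkcond !big_ord_recr big_ord0 /=.
rewrite !big_ord_recr big_ord0 /= !add0r !addr0 ?add0r.
have e0 : widen_ord (leqnSn 3) (widen_ord (leqnSn 2) (widen_ord (leqnSn 1) ord_max)) = o 0.
  by apply: val_inj; rewrite /= inordK.
have e1 : widen_ord (leqnSn 3) (widen_ord (leqnSn 2) ord_max) = o 1%N.
  by apply: val_inj; rewrite /= inordK.
have e2 : widen_ord (leqnSn 3) ord_max = o 2%N by apply: val_inj; rewrite /= inordK.
have e3 : ord_max = o 3 by apply: val_inj; rewrite /= inordK.
rewrite e0 e1 e2 e3.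
have -> : quad (o 0) (o 1%N) = 0 by apply: val_inj; rewrite /= (qE _ _ 0%N).
have -> : quad (o 0) (o 2%N) = 1 by apply: val_inj; rewrite /= (qE _ _ 1%N).
have -> : quad (o 0) (o 3%N) = -1 by apply: val_inj; rewrite /= (qE _ _ 2%N).
have -> : quad (o 1%N) (o 2%N) = -1 by apply: val_inj; rewrite /= (qE _ _ 2%N).
have -> : quad (o 1%N) (o 3%N) = 1 by apply: val_inj; rewrite /= (qE _ _ 1%N).
by have -> : quad (o 2%N) (o 3%N) = 0 by apply: val_inj; rewrite /= (qE _ _ 0%N).
Qed.

Section Duality.
Variables (R : realType) (D : finType) (T : gluing D).
Local Notation C := R[i].
Variable U : D -> 'I_3 -> C.
Variable e : 'I_#|D| -> tedge D.
Hypothesis oT : oriented_gluing T.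
Hypothesis eT : edge_enum T e.
Hypothesis Usum : forall j, \sum_k U j k = 0.
Hypothesis Uedge : forall x : tedge D, x.2.1 != x.2.2 -> edge_sum T U x = 0.
Hypothesis Ucurve : forall m (c : 'I_m.+1 -> arc D), peripheral_curve T R c ->
  \sum_i (arc_sign (c i))%:~R * U (c i).1.1 (arc_quad (c i)) = 0.

(** The three edges of a face have the three different quads. *)
Lemma side_value_triangle j (u v f : 'I_4) : uniq [:: u; v; f] ->
  side_value U j (quad u v) + side_value U j (quad u f) + side_value U j (quad v f) = 0.
Proof.
move/quad_third; set k := quad u v; rewrite -(sum_side_value U j).
rewrite (reindex_inj (addrI k)) sum_I3 addr0.
case: ifP => _ [-> ->] //.
by rewrite -addrA [X in _ + X]addrC addrA.
Qed.

(** The weights [w] of the edges are the logarithms of the lambda lengths of the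
    horospherical structure whose link sides have log-lengths [side_value + g]. *)
Lemma edge_weights : exists w : tedge D -> C,
  (forall x y, x.2.1 != x.2.2 -> edge_eq T x y -> w x = w y) /\
  forall F : D -> 'I_3 -> C, (forall j, \sum_k F j k = 0) -> forall j,
    \sum_(uv : 'I_4 * 'I_4 | (uv.1 < uv.2)%N) w (j, uv) * F j (quad uv.1 uv.2) =
    U j 0 * F j 1 - U j 1 * F j 0.
Proof.
have [g gE] := link_potential oT Usum Uedge Ucurve.
pose w (y : tedge D) := (side_value U y.1 (quad y.2.1 y.2.2)
                         - g (y.1, y.2.1) - g (y.1, y.2.2)) / 2.
exists w; split.
  move=> x y; move=> /[swap] h; elim: h => {x y} [x y|//|x y h IH ne|x y z h1 IH1 h2 IH2 ne].
  - case=> [[j f u v fu fv] /= uv|-> _]; last first.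
      by rewrite /w /= quadC; congr (_ / _); rewrite addrAC.
    (* Across the face [f], the values of [g] at [u] and [v] change by the jumps on [uf] and [vf];
       as side values sum to zero on a face, this offsets the jump on [uv]. *)
    rewrite /w /= !gE // /link_weight /=; congr (_ / _).
    have h1 := @side_value_triangle j u v f.
    have h2 := @side_value_triangle (T j f).1 ((T j f).2 u) ((T j f).2 v) ((T j f).2 f).
    have un : uniq [:: u; v; f] by rewrite /= !inE !negb_or uv (eq_sym u) fu (eq_sym v) fv.
    have un' : uniq [:: (T j f).2 u; (T j f).2 v; (T j f).2 f].
      by rewrite -(map_inj_uniq (@perm_inj _ (T j f).2)) in un.
    move: (h1 un) (h2 un') => {h1 h2}.
    set a := side_value _ _ _; set b := side_value _ _ _; set c := side_value _ _ _.
    move=> /eqP; rewrite -addrA addr_eq0 => /eqP ->.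
    by move=> /eqP; rewrite -addrA addr_eq0 => /eqP ->; ring.
  - by rewrite IH // (edge_eq_nondeg h).
  - by rewrite IH1 // IH2 // -(edge_eq_nondeg h1).
move=> F F0 j; set SV := side_value U j.
apply: etrans (sum_edges (fun u v k => (SV k - g (j, u) - g (j, v)) / 2 * F j k)) _ => /=.
set o := inord.
have d0 : U j 0 = SV 1 - SV (-1) by rewrite -(side_value_diff Usum) add0r sub0r.
have d1 : U j 1 = SV (-1) - SV 0.
  by rewrite -(side_value_diff Usum) subrr; congr (SV _ - _); apply: val_inj.
(* Each vertex lies on one edge of each quad, so the terms in [g] carry the factor [\sum_k F j k]
   and vanish. *)
have := F0 j; rewrite sum_I3 => /eqP; rewrite addr_eq0 => /eqP f2.
have {f2} f2 : F j (-1) = - (F j 0 + F j 1) by rewrite f2 opprK.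
by rewrite d0 d1 f2; field.
Qed.

(** By [edge_weights] the pairing is a sum over the edges of tetrahedra. Grouped by edge classes, on
    which [w] is constant, it is a combination of the vanishing edge sums of [F]. *)
Lemma quad_duality (F : D -> 'I_3 -> C) : (forall j, \sum_k F j k = 0) ->
  (forall i, edge_sum T F (e i) = 0) ->
  \sum_j (U j 0 * F j 1 - U j 1 * F j 0) = 0.
Proof.
move=> F0 Fe; have [w [wE wF]] := edge_weights.
transitivity (\sum_(y : tedge D | (y.2.1 < y.2.2)%N) w y * F y.1 (quad y.2.1 y.2.2)).
  under eq_bigr do rewrite -wF //.
  by rewrite pair_big_dep /=; apply: eq_big => -[].
have [_ eU] := eT.
have ne (y : tedge D) : (y.2.1 < y.2.2)%N -> y.2.1 != y.2.2 by rewrite neq_ltn => ->.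
transitivity (\sum_i \sum_(y : tedge D | (y.2.1 < y.2.2)%N && `[< edge_eq T y (e i) >])
     w y * F y.1 (quad y.2.1 y.2.2)).
  rewrite (exchange_big_dep (fun y : tedge D => (y.2.1 < y.2.2)%N)) /=; last first.
    by move=> i y _ /andP[].
  apply: eq_bigr => y lt; have [i [ei iU]] := eU y (ne _ lt).
  rewrite (big_pred1 i) // => i'; rewrite lt /=; apply/asboolP/eqP => [/iU-> //|->//].
rewrite big1 // => i _.
transitivity (w (e i) * edge_sum T F (e i)); last by rewrite Fe mulr0.
rewrite edge_sumE mulr_sumr; apply: eq_bigr => y /andP[lt /asboolP h].
by rewrite (wE _ _ (ne _ lt) h).
Qed.

End Duality.

(** * Flattenings *)

Section ComplexExp.
Variable R : realType.
Local Notation C := R[i].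

Lemma cexpD (x y : C) : cexp (x + y) = cexp x * cexp y.
Proof.
case: x y => [a b] [c d]; rewrite /cexp /= expRD cosD sinD.
by apply/eqP; rewrite eq_complex /=; apply/andP; split; apply/eqP; ring.
Qed.

Lemma cexp0 : cexp (0 : C) = 1.
Proof.
by rewrite /cexp /= expR0 cos0 sin0; apply/eqP; rewrite eq_complex /= !mul1r ?mul0r subr0 addr0 !eqxx.
Qed.

Lemma cexpN (x : C) : cexp (- x) = (cexp x)^-1.
Proof.
have h : cexp x * cexp (- x) = 1 by rewrite -cexpD subrr cexp0.
have nz : cexp x != 0 by apply: contra_eq_neq h => ->; rewrite mul0r eq_sym oner_neq0.
by apply: (mulfI nz); rewrite h mulfV.
Qed.

Lemma cexp_sum (I : finType) (F : I -> C) : cexp (\sum_i F i) = \prod_i cexp (F i).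
Proof. exact: (big_morph _ cexpD cexp0). Qed.

Lemma cexpMz (x : C) (n : int) : cexp (x * n%:~R) = cexp x ^ n.
Proof.
have nat_case k : cexp (x * k%:R) = cexp x ^+ k.
  elim: k => [|k IH]; first by rewrite mulr0 cexp0 expr0.
  by rewrite mulrSr mulrDr mulr1 cexpD IH exprSr.
case: n => k; first by rewrite -pmulrn nat_case.
by rewrite NegzE mulrNz mulrN cexpN -pmulrn nat_case exprnN.
Qed.

Lemma cexp_pi : cexp (pi%:C * 'i : C) = -1.
Proof.
rewrite /cexp /= ; apply/eqP; rewrite eq_complex /=.
rewrite !mulr0 !mul0r !mulr1 !addr0 ?subr0 expR0 cospi sinpi.
by rewrite !mul1r ?mul0r ?subr0 ?addr0 ?oppr0 !eqxx.
Qed.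

End ComplexExp.

Lemma intr_sign (R : unitRingType) (n : int) : exists b : bool, (-1 : R) ^ n = (-1) ^+ b.
Proof.
exists (odd `|n|%N); case: n => k; first by rewrite signr_odd.
by rewrite signr_odd -[LHS]/((-1) ^- k.+1) invr_sign.
Qed.

(** On triples of sum zero this area form is invariant under cyclic rotation of the indices, so it
    can be computed relative to any quad type. *)
Lemma wedge_rotate (A : comPzRingType) (u v : 'I_3 -> A) (k : 'I_3) :
  \sum_p u p = 0 -> \sum_p v p = 0 ->
  u k * v (k + 1) - u (k + 1) * v k = u 0 * v 1 - u 1 * v 0.
Proof.
rewrite !sum_I3 => /eqP; rewrite addr_eq0 => /eqP eu /eqP; rewrite addr_eq0 => /eqP ev.
have e0 : u (-1) = - (u 0 + u 1) by rewrite eu opprK.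
have e1 : v (-1) = - (v 0 + v 1) by rewrite ev opprK.
have [->|[->|->]] : k = 0 \/ k = 1 \/ k = -1.
- by case: k => [[|[|[|k]]] lt] //; [left|right; left|right; right]; apply: val_inj.
- by rewrite add0r.
- have -> : 1 + 1 = -1 :> 'I_3 by apply: val_inj.
  by rewrite e0 e1; ring.
- by rewrite addNr e0 e1; ring.
Qed.

Section Flattening.
Variables (D : finType) (T : gluing D) (q : D -> 'I_3).

(** Column vectors indexed by the number of primes, as functions of the quads. *)
Definition by_quad (V : Type) (X : 'I_3 -> 'cV[V]_#|D|) (j : D) (k : 'I_3) : V :=
  X (k - q j) (enum_rank j) 0.

Lemma sum_by_quad (V : zmodType) (X : 'I_3 -> 'cV[V]_#|D|) j :
  \sum_k by_quad X j k = (\sum_p X p) (enum_rank j) 0.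
Proof.
rewrite summxE (reindex_inj (addIr (q j))); apply: eq_bigr => p _.
by rewrite /by_quad addrK.
Qed.

Lemma sum_enum_val (V : zmodType) (F : D -> V) : \sum_(j < #|D|) F (enum_val j) = \sum_j F j.
Proof.
rewrite [RHS](reindex (@enum_val D D)) //=.
by apply: onW_bij; apply: enum_val_bij.
Qed.

Lemma gluing_mx_mul (A : pzRingType) (e : 'I_#|D| -> tedge D) (X : 'I_3 -> 'cV[A]_#|D|) i :
  (\sum_p map_mx intr (gluing_mx T q e p) *m X p) i 0 = edge_sum T (by_quad X) (e i).
Proof.
rewrite summxE /edge_sum -sum_enum_val.
under eq_bigr do rewrite mxE.
rewrite exchange_big /=; apply: eq_bigr => j _.
rewrite [RHS](reindex_inj (addrI (q (enum_val j)))); apply: eq_bigr => p _.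
rewrite !mxE /by_quad addrAC subrr add0r enum_valK.
by rewrite mulr_natl.
Qed.

Lemma curve_mx_mul (A : pzRingType) m (c : 'I_m.+1 -> arc D) (X : 'I_3 -> 'cV[A]_#|D|) :
  (\sum_p map_mx intr (curve_mx q c p) *m X p) 0 0 =
  \sum_i (arc_sign (c i))%:~R * by_quad X (c i).1.1 (arc_quad (c i)).
Proof.
rewrite summxE.
transitivity (\sum_p \sum_r \sum_(i | ((c i).1.1 == enum_val r)
    && (arc_quad (c i) == q (enum_val r) + p)) (arc_sign (c i))%:~R * X p r 0).
  apply: eq_bigr => p _; rewrite mxE; apply: eq_bigr => r _.
  by rewrite !mxE rmorph_sum mulr_suml.
under eq_bigr do rewrite (exchange_big_dep xpredT) //=.
rewrite exchange_big /=; apply: eq_bigr => i _.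
rewrite (bigD1 (arc_quad (c i) - q (c i).1.1)) //= [X in _ + X]big1 ?addr0.
  rewrite (big_pred1 (enum_rank (c i).1.1)) // => r /=; apply/andP/eqP => [[/eqP -> _]|->].
    by rewrite enum_valK.
  by rewrite enum_rankK eqxx addrC subrK.
move=> p ne; rewrite big1 // => r /andP[/eqP e1 /eqP e2].
by move: ne; rewrite e2 e1 addrAC subrr add0r eqxx.
Qed.

Section Sign.
Variables (R : realType) (e : 'I_#|D| -> tedge D) (z : D -> R[i]).
Variable f : 'I_3 -> 'cV[int]_#|D|.
Local Notation C := R[i].
Hypothesis oT : oriented_gluing T.
Hypothesis eT : edge_enum T e.
Hypothesis logz : log_gluing_equations T q e z.
Hypothesis flatf : flattening T q R e f.

(** The vectors [Y = L - pi i f] satisfy the homogeneous equations, so the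
    symplectic pairing of [Y] with [d] vanishes and that of [L] with [d] is
    [pi i] times an integer. *)
Lemma zeta_flattening_sign (d : 'I_3 -> 'cV[int]_#|D|) :
  \sum_p d p = 0 -> \sum_p gluing_mx T q e p *m d p = 0 ->
  exists b : bool, \prod_j \prod_p zeta (z (enum_val j)) p ^ d p j 0 = (-1) ^+ b.
Proof.
move=> d0 de; have [L [Lz Lsum Ledge Lcurve]] := logz; have [fe fsum fcurve] := flatf.
pose ipi : C := pi%:C * 'i.
pose Y p : 'cV[C]_#|D| := L p - ipi *: map_mx intr (f p).
pose F p : 'cV[C]_#|D| := map_mx intr (d p).
have Ysum : \sum_p Y p = 0.
  rewrite sumrB Lsum -scaler_sumr -(map_mx_sum intr) fsum.
  by apply/matrixP => i k; rewrite !mxE mulr1 subrr.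
have Yedge : \sum_p map_mx intr (gluing_mx T q e p) *m Y p = 0.
  under eq_bigr do rewrite mulmxBr -scalemxAr -map_mxM.
  rewrite sumrB Ledge -scaler_sumr -map_mx_sum fe.
  by apply/matrixP => i k; rewrite !mxE /ipi; ring.
have Ycurve m (c : 'I_m.+1 -> arc D) : peripheral_curve T R c ->
    \sum_p map_mx intr (curve_mx q c p) *m Y p = 0.
  move=> pc; under eq_bigr do rewrite mulmxBr -scalemxAr -map_mxM.
  rewrite sumrB Lcurve // -scaler_sumr -map_mx_sum fcurve //.
  by apply/matrixP => i k; rewrite !mxE mulr0 subrr.
have Fsum : \sum_p F p = 0 by rewrite -map_mx_sum d0 map_mx0.
have Fedge : \sum_p map_mx intr (gluing_mx T q e p) *m F p = 0.
  by under eq_bigr do rewrite -map_mxM; rewrite -map_mx_sum de map_mx0.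
have Fsum' j : \sum_k by_quad F j k = 0 by rewrite sum_by_quad Fsum mxE.
have Ysum' j : \sum_k by_quad Y j k = 0 by rewrite sum_by_quad Ysum mxE.
have class X (x : tedge D) : (forall i, edge_sum T X (e i) = 0 :> C) ->
    x.2.1 != x.2.2 -> edge_sum T X x = 0.
  move=> X0 ne; have [i [xi _]] := eT.2 x ne; rewrite -(X0 i) !edge_sumE.
  apply: eq_bigl => y; congr (_ && _); apply/asboolP/asboolP => h; first exact: rst_trans h xi.
  by apply: rst_trans h _; apply: rst_sym.
have Yedge' (x : tedge D) : x.2.1 != x.2.2 -> edge_sum T (by_quad Y) x = 0.
  by apply: class => i; rewrite -gluing_mx_mul Yedge mxE.
have Ycurve' m (c : 'I_m.+1 -> arc D) : peripheral_curve T R c ->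
    \sum_i (arc_sign (c i))%:~R * by_quad Y (c i).1.1 (arc_quad (c i)) = 0.
  by move=> pc; rewrite -curve_mx_mul Ycurve // mxE.
have Fedge' i : edge_sum T (by_quad F) (e i) = 0 by rewrite -gluing_mx_mul Fedge mxE.
have dual := quad_duality oT eT Ysum' Yedge' Ycurve' Fsum' Fedge'.
have {dual} dual : \sum_r (Y 0 r 0 * F 1 r 0 - Y 1 r 0 * F 0 r 0) = 0.
  rewrite -[RHS]dual -[RHS]sum_enum_val; apply: eq_bigr => r _.
  rewrite -(@wedge_rotate C (by_quad Y (enum_val r)) (by_quad F (enum_val r)) (q (enum_val r))) //.
  by rewrite /by_quad subrr addrAC subrr add0r enum_valK.
(* [zeta] is [1 / z], [zeta'] equals [z'], and [zeta''] is [- zeta * zeta'], whose sign contributes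
   [ipi]. *)
have zetaE j p : zeta (z (enum_val j)) p = cexp (match val p with
    0%N => - L 0 j 0 | 1%N => L 1 j 0 | _ => L 1 j 0 - L 0 j 0 + ipi end).
  have := Lz 0 j; have := Lz 1 j; rewrite /shape /zeta /= => e1 e0.
  case: p => [[|[|p]] lt] /=; rewrite ?cexpD ?cexpN ?e1 ?e0 // cexp_pi.
  by rewrite -(opprB 1) mulrN invrN invfM mulrN1 [in RHS]mulrC.
(* As [d] sums to zero, the logarithm of the product is the pairing of [L] with [d] plus [ipi] times
   the entries of [d (-1)]. Substituting [L = Y + ipi f] leaves [ipi N], by [dual]. *)
pose N : int := \sum_r (f 0 r 0 * d 1 r 0 - f 1 r 0 * d 0 r 0 + d (-1) r 0).
have [b Nb] := @intr_sign C N; exists b; rewrite -Nb -cexp_pi -cexpMz.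
under eq_bigr do under eq_bigr do rewrite zetaE -cexpMz.
under eq_bigr do rewrite -cexp_sum.
rewrite -cexp_sum; congr cexp; apply/eqP; rewrite -subr_eq0 rmorph_sum mulr_sumr -sumrB.
apply/eqP; rewrite -[RHS]dual; apply: eq_bigr => r _.
have e2 : d (-1) r 0 = - (d 0 r 0 + d 1 r 0).
  have := congr1 (fun M : 'cV[int]__ => M r 0) d0; rewrite summxE sum_I3 mxE.
  by move=> /eqP; rewrite addrC addr_eq0 => /eqP.
by rewrite sum_I3 e2 !mxE /= -/ipi; ring.
Qed.

End Sign.

End Flattening.

(** * Covers *)

Definition map_edge (D1 D2 : Type) (phi : D1 -> D2) (x : tedge D1) : tedge D2 :=
  (phi x.1, x.2).

Definition gluing_morphism (D1 D2 : Type) (T1 : gluing D1) (T2 : gluing D2)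
    (phi : D1 -> D2) :=
  forall x f, T2 (phi x) f = (phi (T1 x f).1, (T1 x f).2).

Lemma edge_eq_map (D1 D2 : Type) (T1 : gluing D1) (T2 : gluing D2) (phi : D1 -> D2) x y :
  gluing_morphism T1 T2 phi -> edge_eq T1 x y ->
  edge_eq T2 (map_edge phi x) (map_edge phi y).
Proof.
move=> hphi; elim=> {x y} [x y h|x|x y _ h|x y z _ h1 _ h2].
- apply: rst_step; case: h => [[j f u v fu fv]|->]; last by right.
  left; rewrite /map_edge /=; have := GlueEdge T2 (phi j) fu fv.
  by rewrite hphi.
- exact: rst_refl.
- exact: rst_sym.
- exact: rst_trans h1 h2.
Qed.

Lemma edge_eq_iso (D1 D2 : Type) (T1 : gluing D1) (T2 : gluing D2)
    (phi : D1 -> D2) (psi : D2 -> D1) x y :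
  gluing_morphism T1 T2 phi -> cancel phi psi -> cancel psi phi ->
  edge_eq T2 (map_edge phi x) (map_edge phi y) <-> edge_eq T1 x y.
Proof.
move=> hphi phiK psiK; split; last exact: edge_eq_map.
have hpsi : gluing_morphism T2 T1 psi.
  by move=> z f; rewrite -{2 3}(psiK z) hphi /= phiK -surjective_pairing.
by move=> /(edge_eq_map hpsi); rewrite /map_edge /= !phiK -!surjective_pairing.
Qed.

Lemma nedges_class (D : Type) (T : gluing D) x k y y' :
  edge_eq T y y' -> nedges T x k y = nedges T x k y'.
Proof.
move=> h; rewrite /nedges; congr #|pred_of_set _|; apply/setP => uv; rewrite !inE.
congr [&& _, _ & _]; apply/asboolP/asboolP => h'; first exact: rst_trans h' h.
by apply: rst_trans h' _; apply: rst_sym.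
Qed.

Lemma nedges_iso (D1 D2 : Type) (T1 : gluing D1) (T2 : gluing D2)
    (phi : D1 -> D2) (psi : D2 -> D1) x k y :
  gluing_morphism T1 T2 phi -> cancel phi psi -> cancel psi phi ->
  nedges T2 (phi x) k (map_edge phi y) = nedges T1 x k y.
Proof.
move=> hphi phiK psiK; rewrite /nedges; congr #|pred_of_set _|; apply/setP => uv; rewrite !inE.
congr [&& _, _ & _].
by apply/asboolP/asboolP => h; apply/(edge_eq_iso (x, uv) y hphi phiK psiK).
Qed.

Lemma walk_base (D : Type) (T : gluing D) j w :
  (walk T (j, None) w).1 = foldl (fun x f => (T x f).1) j w.
Proof. by elim: w j => //= f w IH j; rewrite -IH. Qed.

Lemma cocycle_opp (D : Type) (T : gluing D) a : cocycle T a ->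
  forall j f, a (T j f).1 ((T j f).2 f) = - a j f.
Proof.
move=> ca j f; have := ca j [:: f; (T j f).2 f] (Backtrack T j (ov := None) isT).
by rewrite /= addr0 => /eqP; rewrite addrC addr_eq0 => /eqP.
Qed.

Section Cover.
Variables (D : Type) (A : zmodType) (T : gluing D) (a : D -> 'I_4 -> A).

Lemma cover_proj : gluing_morphism (cover T a) T fst.
Proof. by move=> x f; rewrite /cover /= -surjective_pairing. Qed.

Definition shift (d : A) (x : D * A) : D * A := (x.1, x.2 + d).

Lemma cover_shift d : gluing_morphism (cover T a) (cover T a) (shift d).
Proof. by move=> x f; rewrite /cover /shift /= addrAC. Qed.

Lemma shiftK d : cancel (shift d) (shift (- d)).
Proof. by case=> j h; rewrite /shift /= addrK. Qed.

Lemma shiftNK d : cancel (shift (- d)) (shift d).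
Proof. by case=> j h; rewrite /shift /= addrNK. Qed.

Lemma nedges_shift j h k d y :
  nedges (cover T a) (j, h) k (map_edge (shift d) y) = nedges (cover T a) (j, h - d) k y.
Proof.
rewrite -(nedges_iso (j, h - d) k y (cover_shift d) (shiftK d) (shiftNK d)).
by rewrite /shift /= subrK.
Qed.

(** Each elementary identification lifts from any height; the change [d] of height is the same for
    all of them, by translation. *)
Lemma edge_eq_lift x y : edge_eq T x y -> exists d, forall h,
  edge_eq (cover T a) ((x.1, h), x.2) ((y.1, h + d), y.2).
Proof.
elim=> {x y} [x y h|x|x y _ [d IH]|x y z _ [d IH] _ [d' IH']].
- case: h => [[j f u v fu fv]|->]; last first.
    by exists 0 => h; rewrite addr0; apply: rst_step; right.
  by exists (a j f) => h; apply: rst_step; left; apply: (GlueEdge (cover T a) (j, h) fu fv).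
- by exists 0 => h; rewrite addr0; apply: rst_refl.
- by exists (- d) => h; apply: rst_sym; have := IH (h - d); rewrite subrK.
- by exists (d + d') => h; apply: rst_trans (IH h) _; rewrite addrA; apply: IH'.
Qed.

End Cover.

Section CoverInvolutive.
Variables (D : eqType) (A : zmodType) (T : gluing D) (a : D -> 'I_4 -> A).
Hypothesis Tinv : involutive_gluing T.
Hypothesis aN : forall j f, a (T j f).1 ((T j f).2 f) = - a j f.

Lemma cover_involutive : involutive_gluing (cover T a).
Proof. by move=> [j h] f; rewrite /cover /= Tinv aN addrK. Qed.

End CoverInvolutive.

(** * Heights of edges in the infinite cyclic cover *)

Section Height.
Variables (D : finType) (T : gluing D) (a : D -> 'I_4 -> int).
Hypothesis oT : oriented_gluing T.
Hypothesis ca : cocycle T a.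
Local Notation Tinf := (infinite_cyclic_cover T a).

Let Tinv := oriented_involutive oT.

Lemma iter_turn_cover m j h f g :
  iter m (turn Tinf) ((j, h), f, g) =
  let s := iter m (turn T) (j, f, g) in
  ((s.1.1, h + evalc T a j [seq t.2 | t <- traject (turn T) (j, f, g) m]), s.1.2, s.2).
Proof.
elim: m j h f g => [|m IH] j h f g; first by rewrite /= addr0.
by rewrite !iterSr trajectS IH /= addrA.
Qed.

Lemma turn_cover_closed m j h f g : f != g -> iter m (turn T) (j, f, g) = (j, f, g) ->
  iter m (turn Tinf) ((j, h), f, g) = ((j, h), f, g).
Proof.
move=> fg e; rewrite iter_turn_cover e /= (ca (EdgeLoop fg _ _ e)) // addr0 //.
Qed.

Lemma cover_turn_periodic : turn_periodic Tinf.
Proof.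
move=> [[[j h] f] g]; have [fg|fg] := eqVneq f g.
  by exists 1%N; rewrite -fg /= (cocycle_opp ca) addrK Tinv /= permK.
have [m e] := finite_turn_periodic oT (j, f, g).
by exists m; apply: turn_cover_closed.
Qed.

(** Equivalent edges are related by turns. Those projecting to a closed loop around an edge do not
    change the height, by the cocycle condition, and none projects to a reversal. *)
Lemma height_unique j h h' uv : uv.1 != uv.2 ->
  edge_eq Tinf ((j, h), uv) ((j, h'), uv) -> h = h'.
Proof.
move=> ne e; have [f [g un]] := exists_complement ne.
have [//||m] := edge_eq_turn_conn (cover_involutive Tinv (cocycle_opp ca))
  cover_turn_periodic e (s := ((j, h), f, g)) (t := ((j, h'), f, g)).
- by rewrite /over eqxx.
- by rewrite /over eqxx.
have fg : f != g by move: un; rewrite /= !inE !negb_or => /andP[/andP[]].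
rewrite iter_turn_cover; case E: (iter m (turn T) (j, f, g)) => [[k f'] g'] /=.
case=> [[ek <- ef eg]|[ek eh ef eg]].
  by subst; rewrite (ca (EdgeLoop fg _ _ E)) // addr0.
by case: (@turn_neq_swap _ _ Tinv m (j, f, g) (oriented_fixfree oT) fg); rewrite E ek ef eg.
Qed.

(** Each of the finitely many pairs of vertices contributes at one height at most. The default [0]
    of [xget] is only taken for pairs that contribute nowhere. *)
Lemma nedges_finite_support j k y :
  finite_set [set h | nedges Tinf (j, h) k y != 0%N]%classic.
Proof.
pose ht uv := xget 0 [set h | edge_eq Tinf ((j, h), uv) y]%classic.
apply: (@sub_finite_set _ _ (ht @` [set: 'I_4 * 'I_4])%classic); last first.
  by apply: finite_image; apply: finite_finset.
move=> h /=; rewrite -lt0n => /card_gt0P[uv]; rewrite inE => /and3P[lt _ /asboolP e].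
exists uv => //; rewrite /ht; case: xgetP => [h' _ /= e'|/(_ h)/=//].
apply: (@height_unique j _ _ uv); first by rewrite neq_ltn lt.
by apply: rst_trans e' _; apply: rst_sym.
Qed.

End Height.

Section Residue.
Variable n : nat.

(** The class modulo [n.+1], in the form in which sheets occur in [cyclic_cover]. *)
Definition residue (z : int) : 'I_n.+1 := Zp1 *~ z.

Lemma residueD z1 z2 : residue (z1 + z2) = residue z1 + residue z2.
Proof. exact: mulrzDr. Qed.

Lemma residueN z : residue (- z) = - residue z.
Proof. by rewrite /residue mulrNz. Qed.

Lemma val_residue (k : nat) : residue k = (k %% n.+1)%N :> nat.
Proof.
rewrite /residue -pmulrn.
by rewrite Zp_mulrn /= modnMml mul1n.
Qed.

Lemma residue_ord (k : 'I_n.+1) : residue k = k.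
Proof. by apply: val_inj; rewrite /= val_residue modn_small. Qed.

Lemma residueM z : residue (n.+1%:Z * z) = 0.
Proof.
rewrite /residue mulrzA.
have -> : (Zp1 : 'I_n.+1) *~ n.+1%:Z = 0.
  by apply: val_inj; rewrite /= -/(residue n.+1%:Z) val_residue modnn.
by rewrite mul0rz.
Qed.

Lemma residue_eq0 z : residue z = 0 -> exists h, z = n.+1%:Z * h.
Proof.
rewrite {1}(divz_eq z n.+1%:Z) mulrC residueD residueM add0r => e.
exists (z %/ n.+1%:Z)%Z; rewrite {1}(divz_eq z n.+1%:Z) mulrC.
have : (0 <= (z %% n.+1%:Z)%Z) by apply: modz_ge0.
have : ((z %% n.+1%:Z)%Z < n.+1%:Z) by apply: ltz_pmod.
move: e; case: (z %% n.+1%:Z)%Z => // k /(congr1 val) /=.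
by rewrite val_residue => e lt _; rewrite modn_small // in e; rewrite e addr0.
Qed.

End Residue.
Arguments residue {n} z.

Section CyclicCover.
Variables (D : finType) (T : gluing D) (a : D -> 'I_4 -> int) (n : nat).
Variable b : D * 'I_n.+1 -> 'I_4 -> int.
Hypothesis oT : oriented_gluing T.
Hypothesis ca : cocycle T a.
Hypothesis db : divided_cocycle T a b.
Local Notation Tcyc := (cyclic_cover T a n).
Local Notation Tinf := (infinite_cyclic_cover T a).
Local Notation Tinf' := (infinite_cyclic_cover Tcyc b).

Let Tinv := oriented_involutive oT.

Lemma cyclic_cover_involutive : involutive_gluing Tcyc.
Proof. by apply: cover_involutive => // j f; rewrite (cocycle_opp ca) mulrNz. Qed.

(** The cochain [a - n.+1 * b] vanishes on all loops of the cyclic cover, so it is a coboundary.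
    Modulo [n.+1] it changes as the sheet does, so the potential can be normalised to reduce to the
    sheet. *)
Lemma height_potential : exists r : D * 'I_n.+1 -> int,
  (forall x, residue (r x) = x.2) /\
  forall x f, r (Tcyc x f).1 = r x + (a x.1 f - n.+1%:Z * b x f).
Proof.
pose step x f := (Tcyc x f).1.
pose c (x : D * 'I_n.+1) f := a x.1 f - n.+1%:Z * b x f.
have [cb eb] := db.
have sumE x w : path_sum step c x w = evalc T a x.1 w - n.+1%:Z * evalc Tcyc b x w.
  elim: w x => [|f w IH] x /=; first by rewrite mulr0 subr0.
  by rewrite IH /c; ring.
have rev x f : true -> exists f', [/\ true, step (step x f) f' = x & c (step x f) f' = - c x f].
  move=> _; exists ((Tcyc x f).2 f); split => //.
    by rewrite /step cyclic_cover_involutive.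
  by rewrite /c (cocycle_opp cb) /= (cocycle_opp ca) mulrN opprB opprK addrC.
have closed x w : path_ok step (fun _ _ => true) x w -> foldl step x w = x ->
    path_sum step c x w = 0.
  by move=> _ e; rewrite sumE eb ?subrr // /is_loop walk_base.
have [||r [rP rS]] := potential rev closed (P := fun x v => residue v = x.2).
- by move=> [j k]; exists (k : nat)%:Z; apply: residue_ord.
- by move=> x f v _ ev; rewrite /c !residueD residueN residueM subr0 ev.
by exists r; split => // x f; apply: rS.
Qed.

Section Unwrap.
Variable r : D * 'I_n.+1 -> int.
Hypothesis r_residue : forall x, residue (r x) = x.2.
Hypothesis rS : forall x f, r (Tcyc x f).1 = r x + (a x.1 f - n.+1%:Z * b x f).

(** The infinite cyclic cover of the cyclic cover is that of the base, with
    heights multiplied by [n.+1]. *)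
Definition unwrap (x : D * 'I_n.+1 * int) : D * int := (x.1.1, n.+1%:Z * x.2 + r x.1).

(** The division is exact, as [r x] and [y.2] have the same residue. *)
Definition rewrap (y : D * int) : D * 'I_n.+1 * int :=
  let x := (y.1, residue y.2) in (x, ((y.2 - r x) %/ n.+1%:Z)%Z).

Lemma unwrapK : cancel unwrap rewrap.
Proof.
case=> [[j k] h]; rewrite /rewrap /unwrap /=.
by rewrite residueD residueM add0r r_residue /= addrK mulKz.
Qed.

Lemma rewrapK : cancel rewrap unwrap.
Proof.
case=> j h; rewrite /rewrap /unwrap /=; congr (_, _).
have [h' e] : exists h', h - r (j, residue h) = n.+1%:Z * h'.
  by apply: (@residue_eq0 n); rewrite residueD residueN r_residue subrr.
by rewrite e mulKz // -e subrK.
Qed.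

Lemma unwrap_morphism : gluing_morphism Tinf' Tinf unwrap.
Proof.
move=> [x h] f; rewrite /unwrap /= rS; congr (_, _, _).
by rewrite /=; ring.
Qed.

Lemma unwrap_shift h x : unwrap (shift h x) = shift (n.+1%:Z * h) (unwrap x).
Proof. by rewrite /unwrap /shift /= mulrDr addrAC. Qed.

Variable e : 'I_#|D| -> tedge (D * int).
Variable e' : 'I_#|{: D * 'I_n.+1}| -> tedge (D * 'I_n.+1 * int).
Hypothesis lift_e : edge_lifts T e.
Hypothesis lift_e' : edge_lifts Tcyc e'.

(** Two indices with the same [pi] and residue of [eta] give unwrapped edges differing by a
    translation by a multiple of [n.+1]. This is a deck transformation over the cyclic cover, where
    the edges thus coincide. *)
Lemma edge_position : exists pi : 'I_#|{: D * 'I_n.+1}| -> 'I_#|D|,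
  exists eta : 'I_#|{: D * 'I_n.+1}| -> int,
  (forall i, edge_eq Tinf (map_edge unwrap (e' i)) (map_edge (shift (eta i)) (e (pi i)))) /\
  injective (fun i => (pi i, residue (eta i) : 'I_n.+1)).
Proof.
have ex i : exists p : 'I_#|D| * int,
    edge_eq Tinf (map_edge unwrap (e' i)) (map_edge (shift p.2) (e p.1)).
  have [k [ek _]] := lift_e.2 (map_edge (fst \o unwrap) (e' i)) (lift_e'.1 i).
  have [d ed] := edge_eq_lift a ek.
  (* The edge lies over [e k] at height [h + d], while the chosen lift has height [(e k).1.2]. *)
  pose h := (unwrap (e' i).1).2; exists (k, h + d - (e k).1.2) => /=.
  have -> : map_edge (shift (h + d - (e k).1.2)) (e k) = (((e k).1.1, h + d), (e k).2).
    by rewrite /map_edge /shift addrC subrK.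
  exact: (ed h).
have /choice[p pE] := ex.
exists (fun i => (p i).1), (fun i => (p i).2); split => // i k [e1 e2].
have [h eh] : exists h, (p i).2 - (p k).2 = n.+1%:Z * h.
  by apply: (@residue_eq0 n); rewrite residueD residueN e2 subrr.
have : edge_eq Tinf (map_edge unwrap (e' i)) (map_edge unwrap (map_edge (shift h) (e' k))).
  apply: rst_trans (pE i) _; apply: rst_sym.
  have -> : map_edge unwrap (map_edge (shift h) (e' k)) =
            map_edge (shift (n.+1%:Z * h)) (map_edge unwrap (e' k)).
    by rewrite /map_edge /= unwrap_shift.
  have -> : map_edge (shift (p i).2) (e (p i).1) =
            map_edge (shift (n.+1%:Z * h)) (map_edge (shift (p k).2) (e (p k).1)).
    by rewrite /map_edge /shift /= e1 -eh -addrA (addrC (p k).2) subrK.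
  exact: edge_eq_map (cover_shift T a _) (pE k).
move/(edge_eq_iso _ _ unwrap_morphism unwrapK rewrapK).
move/(edge_eq_map (cover_proj Tcyc b)).
have [i0 [ei iU]] := lift_e'.2 (map_edge fst (e' i)) (lift_e'.1 i).
move=> h1; rewrite -(iU i); last exact: rst_refl.
exact: iU.
Qed.

End Unwrap.

End CyclicCover.

(** * Determinants and Fourier transform *)

Section FinMatrix.
Variable A : comPzRingType.

Definition fin_mx (I : finType) (M : I -> I -> A) : 'M[A]_#|I| :=
  \matrix_(i, j) M (enum_val i) (enum_val j).

Lemma det_rows (I : finType) (h : 'I_#|I| -> I) (M : I -> I -> A) : injective h ->
  exists b : bool, \det (\matrix_(i, j) M (h i) (enum_val j)) = (-1) ^+ b * \det (fin_mx M).
Proof.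
move=> hI; have hI' : injective (fun i => enum_rank (h i)) by move=> i j /enum_rank_inj/hI.
exists (perm hI'); rewrite -det_perm -det_mulmx -row_permE; congr (\det _).
by apply/matrixP => i j; rewrite !mxE permE enum_rankK.
Qed.

Lemma det_reindex (I : finType) m (h : 'I_m -> I) (M : I -> I -> A) : bijective h ->
  \det (\matrix_(i, j) M (h i) (h j)) = \det (fin_mx M).
Proof.
move=> hB; have e : m = #|I| by rewrite -(bij_eq_card hB) card_ord.
move: h hB; rewrite e => {m e} h /bij_inj hI.
have hI' : injective (fun i => enum_rank (h i)) by move=> i j /enum_rank_inj/hI.
set s := perm hI'.
have -> : \matrix_(i, j) M (h i) (h j) = perm_mx s *m fin_mx M *m perm_mx s^-1.
  rewrite -row_permE -col_permE.
  by apply/matrixP => i j; rewrite !mxE !permE !enum_rankK.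
rewrite !det_mulmx !det_perm odd_permV mulrAC -signr_addb addbb expr0 mul1r //.
Qed.

(** Induction on the number of blocks: [h] lists the block of [ord0] before all the others. *)
Lemma det_fin_block (J : finType) n (B : 'I_n -> J -> J -> A) :
  \det (fin_mx (fun x y : J * 'I_n => if x.2 == y.2 then B x.2 x.1 y.1 else 0)) =
  \prod_w \det (fin_mx (B w)).
Proof.
elim: n B => [|n IH] B.
  rewrite big_ord0; move: (fin_mx _); have -> : #|{: J * 'I_0}| = 0%N.
    by rewrite card_prod card_ord muln0.
  by move=> M; rewrite det_mx00.
rewrite big_ord_recl -IH.
pose h (i : 'I_(#|J| + #|{: J * 'I_n}|)) : J * 'I_n.+1 := match fintype.split i with
  | inl i => (enum_val i, ord0)
  | inr i => ((enum_val i).1, lift ord0 (enum_val i).2) end.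
have hB : bijective h.
  apply: inj_card_bij; last by rewrite card_ord !card_prod !card_ord mulnS.
  move=> i k; rewrite /h -{2}(splitK i) -{2}(splitK k).
  case: (fintype.split i) => u; case: (fintype.split k) => v //= [].
  - by move/enum_val_inj ->.
  - move=> e1 e2'; have e2 : (enum_val u).2 = (enum_val v).2 by apply: val_inj; exact: e2'.
    congr (unsplit (inr _)); apply: enum_val_inj.
    by rewrite [LHS]surjective_pairing e1 e2 -surjective_pairing.
rewrite -(det_reindex _ hB) -(det_lblock _ 0).
congr (\det _); apply/matrixP => i k; rewrite !mxE /h.
case: (fintype.split i) => u; rewrite mxE; case: (fintype.split k) => v;
  by rewrite !mxE //= ?(inj_eq lift_inj).
Qed.

Lemma fin_mx_mul (I : finType) (M N : I -> I -> A) :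
  fin_mx M *m fin_mx N = fin_mx (fun x y => \sum_z M x z * N z y).
Proof.
apply/matrixP => i j; rewrite !mxE.
rewrite [RHS](reindex (@enum_val I I)) /=; first by apply: eq_bigr => k _; rewrite !mxE.
by apply: onW_bij; apply: enum_val_bij.
Qed.

End FinMatrix.

Section Fourier.
Variables (K : fieldType) (J : finType) (n : nat) (om : K).
Hypothesis prim : n.+1.-primitive_root om.
Hypothesis n_neq0 : n.+1%:R != 0 :> K.

(** The discrete Fourier transform in the second index, tensored with the identity on [J]. *)
Definition fourier (x y : J * 'I_n.+1) : K :=
  if x.1 == y.1 then (om ^+ y.2) ^+ x.2 else 0.

Lemma sum_unity_root (r : K) : r ^+ n.+1 = 1 -> r != 1 -> \sum_(w < n.+1) r ^+ w = 0.
Proof.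
move=> r1 ne; have := subrX1 r n.+1; rewrite r1 subrr => /esym/eqP.
by rewrite mulf_eq0 subr_eq0 (negbTE ne) => /eqP.
Qed.

(** By orthogonality, the product with the matrix of inverse powers is the scalar [n.+1]. *)
Lemma det_fourier_neq0 : \det (fin_mx fourier) != 0.
Proof.
pose W (y x : J * 'I_n.+1) : K := if x.1 == y.1 then (om ^+ y.2) ^- x.2 else 0.
have om0 : om != 0.
  by apply/eqP => e; have /esym/eqP := prim_expr_order prim; rewrite e expr0n oner_eq0.
have : \det (fin_mx fourier *m fin_mx W) != 0.
  have -> : fin_mx fourier *m fin_mx W = n.+1%:R%:M.
    rewrite fin_mx_mul; apply/matrixP => i k; rewrite !mxE -(inj_eq enum_val_inj).
    move: (enum_val i) (enum_val k) => [j u] [j' u']; rewrite xpair_eqE.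
    rewrite -(pair_big xpredT xpredT (fun j w => fourier (_, _) (j, w) * W (j, w) (_, _))) /=.
    rewrite (bigD1 j) //= [X in _ + X]big1 ?addr0; last first.
      move=> j0 ne; rewrite big1 // => w _.
      by rewrite /fourier /= eq_sym (negbTE ne) mul0r.
    rewrite /fourier /W /= eqxx (eq_sym j'); case: (j == j') => /=; last first.
      by rewrite big1 // => w _; rewrite mulr0.
    rewrite (eq_bigr (fun w : 'I_n.+1 => (om ^+ u / om ^+ u') ^+ w)); last first.
      by move=> w _; rewrite expr_div_n -!exprM (mulnC w) (mulnC w).
    case: eqVneq => [->|ne].
      rewrite divff ?expf_neq0 //.
      by under eq_bigr do rewrite expr1n; rewrite sumr_const card_ord.
    rewrite sum_unity_root //.
      by rewrite expr_div_n !(exprAC _ _ n.+1) (prim_expr_order prim) !expr1n divr1.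
    apply: contra ne => /eqP h; have : om ^+ u = om ^+ u'.
      by rewrite -[LHS](divfK (expf_neq0 u' om0)) h mul1r.
    by move/eqP; rewrite (eq_prim_root_expr prim) !modn_small.
  by rewrite det_scalar expf_neq0.
by rewrite det_mulmx mulf_eq0 negb_or => /andP[].
Qed.

(** Pairing [w] with [n - w] shows that the square of the product is [om ^+ n] to the power [n.+1],
    which is [1]. *)
Lemma prod_unity_root : exists b : bool, \prod_(w < n.+1) om ^+ w = (-1) ^+ b.
Proof.
set P := \prod_(w < n.+1) _.
have : P ^+ 2 == 1.
  rewrite expr2 {2}/P (reindex_inj rev_ord_inj) /= -big_split /=.
  rewrite (eq_bigr (fun=> om ^+ n)); last first.
    by move=> w _; rewrite -exprD subSS subnKC // -ltnS.
  by rewrite prodr_const card_ord exprAC (prim_expr_order prim) expr1n.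
by rewrite sqrf_eq1 => /orP[/eqP ->|/eqP ->]; [exists false | exists true].
Qed.

End Fourier.

Section IntegerSums.
Variable V : zmodType.

(** Each integer is [sigma k + n.+1 * h] for a single [k], its residue, and a single [h]. *)
Lemma fsum_residue n (F : int -> V) (sigma : 'I_n.+1 -> int) :
  finite_set [set g | F g != 0]%classic -> (forall k, residue (sigma k) = k) ->
  \sum_(k < n.+1) \sum_(h \in [set: int]%classic) F (sigma k + n.+1%:Z * h) =
  \sum_(g \in [set: int]%classic) F g.
Proof.
move=> finF rs; pose S := fset_set [set g | F g != 0]%classic.
have F0 g : g \notin S -> F g = 0.
  by rewrite in_fset_set // notin_setE /= => /negP; rewrite negbK => /eqP.
rewrite [RHS](fsbigTE S F F0).
pose A k := ((fun h => sigma k + n.+1%:Z * h) @` [set: int])%classic.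
transitivity (\sum_(k < n.+1) \sum_(g <- S) if g \in A k then F g else 0).
  apply: eq_bigr => k _.
  rewrite -(fsbig_image _ (fun h : int => sigma k + n.+1%:Z * h) F); last first.
    by move=> h h' _ _ /addrI /mulfI; apply.
  rewrite fsbig_mkcond (@fsbigTE _ _ _ _ S); last first.
    by move=> g /F0 e; rewrite patchE; case: ifP.
  by apply: eq_bigr => g _; rewrite patchE.
rewrite exchange_big; apply: eq_bigr => g _ /=.
rewrite (bigD1 (residue g)) //= mem_set; last first.
  have [h e] : exists h, g - sigma (residue g) = n.+1%:Z * h.
    by apply: residue_eq0; rewrite residueD residueN rs subrr.
  by exists h => //; rewrite -e addrC subrK.
rewrite big1 ?addr0 // => k ne; case: ifPn => [/set_mem[h _ e]|//].
by move: ne; rewrite -e residueD rs residueM addr0 eqxx.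
Qed.

End IntegerSums.

Section SignedPowers.
Variables (K : fieldType) (t : K).
Hypothesis t_neq0 : t != 0.

Definition signed_power (u : K) := exists (b : bool) (r : int), u = (-1) ^+ b * t ^ r.

Lemma signed_power_sign (b : bool) : signed_power ((-1) ^+ b).
Proof. by exists b, 0; rewrite expr0z mulr1. Qed.

Lemma signed_power1 : signed_power 1.
Proof. exact: (signed_power_sign false). Qed.

Lemma signed_power_exp r : signed_power (t ^ r).
Proof. by exists false, r; rewrite mul1r. Qed.

Lemma signed_powerM u v : signed_power u -> signed_power v -> signed_power (u * v).
Proof.
move=> [b [r ->]] [b' [r' ->]]; exists (b (+) b'), (r + r').
by rewrite signr_addb expfzDr // mulrACA.
Qed.

Lemma signed_powerV u : signed_power u -> signed_power u^-1.
Proof.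
by move=> [b [r ->]]; exists b, (- r); rewrite invfM invr_sign invr_expz.
Qed.

Lemma signed_power_prod (I : finType) (F : I -> K) :
  (forall i, signed_power (F i)) -> signed_power (\prod_i F i).
Proof.
by move=> h; apply: big_ind => //; [apply: signed_power1|apply: signed_powerM].
Qed.

Lemma signed_power_neq0 u : signed_power u -> u != 0.
Proof. by move=> [b [r ->]]; rewrite mulf_neq0 ?signr_eq0 ?expfz_neq0. Qed.

End SignedPowers.

Section Unwrap.
Variables (K : fieldType) (J : finType) (n : nat) (om t : K).
Hypothesis prim : n.+1.-primitive_root om.
Hypothesis n_neq0 : n.+1%:R != 0 :> K.
Hypothesis t_neq0 : t != 0.
Variables (cc : 'I_#|J| -> J -> int -> K) (s : J -> int).
Hypothesis fin_cc : forall i j, finite_set [set h | cc i j h != 0]%classic.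
Variables (pi : 'I_#|{: J * 'I_n.+1}| -> 'I_#|J|) (eta : 'I_#|{: J * 'I_n.+1}| -> int).
Hypothesis inj_position : injective (fun i => (pi i, residue (eta i) : 'I_n.+1)).
Variable sigma : J * 'I_n.+1 -> int.
Hypothesis sigma_residue : forall x, residue (sigma x) = x.2.

Let om_neq0 : om != 0.
Proof. by apply/eqP => e; have /esym/eqP := prim_expr_order prim; rewrite e expr0n oner_eq0. Qed.

Definition laurent_mx (x : K) : 'M[K]_#|J| :=
  \matrix_(i, j) \sum_(h \in [set: int]%classic) cc i (enum_val j) (s (enum_val j) + h) * x ^ h.

(** Row [i] stands for the edge [pi i] translated by [eta i], column [x] for a tetrahedron at height
    [sigma x]; each entry collects the heights of one class modulo [n.+1]. *)
Definition unwrapped_mx : 'M[K]_#|{: J * 'I_n.+1}| :=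
  \matrix_(i, x) \sum_(h \in [set: int]%classic)
    cc (pi i) (enum_val x).1 (sigma (enum_val x) + n.+1%:Z * h - eta i) * (t ^+ n.+1) ^ h.

Let expr_residue (w : nat) (z : int) : (om ^+ w) ^ z = (om ^+ w) ^+ (residue z : 'I_n.+1).
Proof.
have [h ->] : exists h, z = (residue z : 'I_n.+1)%:Z + n.+1%:Z * h.
  have [h e] : exists h, z - (residue z : 'I_n.+1)%:Z = n.+1%:Z * h.
    by apply: (@residue_eq0 n); rewrite residueD residueN residue_ord subrr.
  by exists h; rewrite -e addrC subrK.
rewrite residueD residueM addr0 residue_ord expfzDr ?expf_neq0 //.
have -> : (om ^+ w) ^ (n.+1%:Z * h) = 1.
  have e1 : (om ^+ w) ^+ n.+1 = 1 by rewrite exprAC (prim_expr_order prim) expr1n.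
  by rewrite -exprz_exp -exprnP e1 exp1rz.
by rewrite mulr1.
Qed.

(** As [k] and [h] vary, [sigma (j, k) + n.+1 * h] runs once through the integers, and the weight
    [(om ^+ w) ^+ k] depends only on this integer modulo [n.+1]. *)
Lemma laurent_entry w i j (e : int) :
  \sum_(k < n.+1) (om ^+ w) ^+ k * t ^ (sigma (j, k) - e) *
    (\sum_(h \in [set: int]%classic) cc i j (sigma (j, k) + n.+1%:Z * h - e) * (t ^+ n.+1) ^ h)
  = (om ^+ w) ^ e * (om ^+ w * t) ^ s j *
    \sum_(h \in [set: int]%classic) cc i j (s j + h) * (om ^+ w * t) ^ h.
Proof.
have nz : om ^+ w * t != 0 by rewrite mulf_neq0 ?expf_neq0.
pose F g := cc i j (g - e) * (om ^+ w * t) ^ (g - e).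
transitivity ((om ^+ w) ^ e * \sum_(g \in [set: int]%classic) F g); last first.
  rewrite -mulrA; congr (_ * _).
  rewrite (reindex_fsbigT (fun h => s j + h + e)); last first.
    by exists (fun g => g - e - s j) => h; rewrite ?addrK; rewrite addrC ?addKr //; ring.
  rewrite mulr_fsumr; apply: eq_fsbigr => h _.
  by rewrite /F addrK expfzDr // mulrCA.
rewrite -(@fsum_residue _ n F (fun k => sigma (j, k))); last 2 first.
- apply: (@sub_finite_set _ _ ((fun h => h + e) @` [set h | cc i j h != 0])%classic).
    move=> g /= Fg; exists (g - e); rewrite ?subrK //.
    by apply: contraNneq Fg => c0; rewrite /F c0 mul0r.
  exact: finite_image.
- by move=> k; rewrite sigma_residue.
rewrite mulr_sumr; apply: eq_bigr => k _; rewrite !mulr_fsumr; apply: eq_fsbigr => h _.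
rewrite /F expfzMl; set g := sigma (j, k) + _ - e.
have -> : (om ^+ w) ^+ k = (om ^+ w) ^ e * (om ^+ w) ^ g.
  rewrite -expfzDr ?expf_neq0 // addrC subrK expr_residue.
  by rewrite residueD residueM addr0 sigma_residue.
have -> : t ^ g = t ^ (sigma (j, k) - e) * (t ^+ n.+1) ^ h.
  by rewrite -[t ^+ n.+1]/(t ^ n.+1) exprz_exp -expfzDr // addrAC.
by ring.
Qed.

Let V := @fourier K J n om.

(** Up to powers of [t] in rows and columns, [unwrapped_mx] times the Fourier matrix is a row
    permutation of the Fourier matrix times a block diagonal matrix. The two Fourier determinants
    cancel up to sign. *)
Lemma det_unwrapped_mx :
  exists2 u, signed_power t u &
    \det unwrapped_mx = u * \prod_(w < n.+1) \det (laurent_mx (om ^+ w * t)).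
Proof.
pose h i : J * 'I_n.+1 := (enum_val (pi i), residue (eta i)).
have hI : injective h by move=> i k [/enum_val_inj e1 e2]; apply: inj_position; rewrite e1 e2.
pose B w (j j' : J) := (om ^+ w * t) ^ s j' * laurent_mx (om ^+ w * t) (enum_rank j) (enum_rank j').
pose L := diag_mx (\row_i t ^ (- eta i)).
pose S : 'M[K]_#|{: J * 'I_n.+1}| := diag_mx (\row_x t ^ sigma (enum_val x)).
have key : L *m unwrapped_mx *m S *m fin_mx V =
    (\matrix_(i, x) V (h i) (enum_val x)) *m
    fin_mx (fun x y : J * 'I_n.+1 => if x.2 == y.2 then B x.2 x.1 y.1 else 0).
  apply/matrixP => i y; rewrite [LHS]mxE [RHS]mxE.
  have sum_pair (F : J * 'I_n.+1 -> K) : \sum_(x < #|{: J * 'I_n.+1}|) F (enum_val x) =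
      \sum_j \sum_k F (j, k).
    by rewrite sum_enum_val pair_big; apply: eq_bigr => -[].
  move E: (enum_val y) => jw; case: jw E => j w yE.
  pose F1 x := t ^ (- eta i) * (\sum_(h \in [set: int]%classic)
    cc (pi i) x.1 (sigma x + n.+1%:Z * h - eta i) * (t ^+ n.+1) ^ h) * t ^ sigma x * V x (j, w).
  transitivity (\sum_(x < #|{: J * 'I_n.+1}|) F1 (enum_val x)).
    by apply: eq_bigr => x _; rewrite mul_mx_diag mul_diag_mx !mxE yE.
  pose F2 (x : J * 'I_n.+1) := V (h i) x * (if x.2 == w then B x.2 x.1 j else 0).
  transitivity (\sum_(x < #|{: J * 'I_n.+1}|) F2 (enum_val x)); last first.
    by apply: eq_bigr => x _; rewrite !mxE yE.
  rewrite !sum_pair (bigD1 j) //= [X in _ + X]big1 ?addr0; last first.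
    by move=> j' ne; rewrite big1 // => k _; rewrite /F1 /V /fourier /= (negbTE ne) mulr0.
  rewrite [RHS](bigD1 (enum_val (pi i))) //= [X in _ = _ + X]big1 ?addr0; last first.
    by move=> j' ne; rewrite big1 // => k _; rewrite /F2 /V /fourier /= eq_sym (negbTE ne) mul0r.
  rewrite [RHS](bigD1 w) //= [X in _ = _ + X]big1 ?addr0; last first.
    by move=> k ne; rewrite /F2 /= (negbTE ne) mulr0.
  rewrite /F2 /F1 /V /fourier /B /= !eqxx enum_valK mxE enum_rankK -expr_residue mulrA -laurent_entry.
  apply: eq_bigr => k _; rewrite expfzDr //.
  by ring.
have [bV bE] := det_rows V hI.
have Vn0 : \det (fin_mx V) != 0 by apply: det_fourier_neq0.
have Bdet w : \det (fin_mx (B w)) =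
    (\prod_j (om ^+ w * t) ^ s j) * \det (laurent_mx (om ^+ w * t)).
  have -> : fin_mx (B w) = laurent_mx (om ^+ w * t) *m
      diag_mx (\row_j (om ^+ w * t) ^ s (enum_val j)).
    rewrite mul_mx_diag; apply/matrixP => i j; rewrite [LHS]mxE [RHS]mxE /B !enum_valK.
    by rewrite [X in _ = _ * X]mxE mulrC.
  rewrite det_mulmx det_diag mulrC; congr (_ * _).
  rewrite [RHS](reindex (@enum_val J J)) /=; last by apply: onW_bij; apply: enum_val_bij.
  by apply: eq_bigr => j _; rewrite !mxE.
have uL : signed_power t (\det L).
  by rewrite det_diag; apply: signed_power_prod => // i; rewrite mxE; apply: signed_power_exp.
have uS : signed_power t (\det S).
  by rewrite det_diag; apply: signed_power_prod => // i; rewrite mxE; apply: signed_power_exp.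
(* For each [j] the roots of unity multiply to a power of their product, which is [1] or [-1]. *)
have uB : signed_power t (\prod_(w < n.+1) \prod_j (om ^+ w * t) ^ s j).
  rewrite exchange_big; apply: signed_power_prod => // j.
  rewrite -(big_morph (fun x : K => x ^ s j) (fun x y => expfzMl x y (s j)) (exp1rz _ (s j))).
  rewrite big_split prodr_const /=.
  have [b0 ->] := prod_unity_root prim.
  have [b1 b1E] := intr_sign K (s j).
  rewrite expfzMl; apply: signed_powerM => //.
    by case: b0; rewrite ?expr1 ?b1E ?expr0 ?exp1rz;
      [apply: signed_power_sign|apply: signed_power1].
  by rewrite exprnP exprz_exp; apply: signed_power_exp.
exists ((\det L)^-1 * (\det S)^-1 * (-1) ^+ bV * \prod_(w < n.+1) \prod_j (om ^+ w * t) ^ s j).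
  by do !apply: signed_powerM => //; try apply: signed_powerV => //; apply: signed_power_sign.
have := congr1 determinant key; rewrite !det_mulmx bE (det_fin_block (fun w : 'I_n.+1 => B w)).
rewrite (eq_bigr _ (fun (w : 'I_n.+1) _ => Bdet w)) big_split /=.
set X := \det unwrapped_mx => e.
have L0 := signed_power_neq0 t_neq0 uL; have S0 := signed_power_neq0 t_neq0 uS.
apply: (mulfI L0); apply: (mulIf S0); apply: (mulIf Vn0); rewrite e.
by field; rewrite L0 S0.
Qed.

End Unwrap.

(** * Numerators *)

HB.instance Definition _ (R : realType) :=
  GRing.RMorphism.copy (@cst R) (@tofrac {poly R[i]} \o @polyC R[i]).

Section Constants.
Variable R : realType.
Local Notation C := R[i].
Local Notation K := (Ct R).

Lemma indet_neq0 : indet R != 0.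
Proof. by rewrite /indet tofrac_eq0 polyX_eq0. Qed.

Lemma natr_Ct_neq0 n : n.+1%:R != 0 :> K.
Proof.
have -> : n.+1%:R = cst (n.+1%:R : C) by rewrite rmorph_nat.
by rewrite fmorph_eq0 pnatr_eq0.
Qed.

Lemma primitive_root_exists n : exists om : C, n.+1.-primitive_root om.
Proof.
have [r Dp] := closed_field_poly_normal ('X^(n.+1) - 1 : {poly C}).
rewrite (monicP (monic_Xn_sub_1 _ (ltn0Sn n))) scale1r in Dp.
have unity : all n.+1.-unity_root r.
  by apply/allP => z; rewrite -root_prod_XsubC -Dp.
have uniq_r : uniq r by rewrite -separable_prod_XsubC -Dp separable_Xn_sub_1 // pnatr_eq0.
have size_r : (n < size r)%N.
  by rewrite -ltnS -(size_prod_XsubC r id) -Dp size_Xn_sub_1.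
by have /hasP[w _ prim] := has_prim_root (ltn0Sn n) unity uniq_r size_r; exists w.
Qed.

Lemma prod_unity_roots n (om : C) (F : C -> K) : n.+1.-primitive_root om ->
  \big[*%R/1]_(w \in [set w : C | w ^+ n.+1 = 1]%classic) F w = \prod_(k < n.+1) F (om ^+ k).
Proof.
move=> prim.
have inj : injective (fun k : 'I_n.+1 => om ^+ k).
  move=> i k /eqP; rewrite (eq_prim_root_expr prim) !modn_small // => /eqP.
  exact: val_inj.
rewrite (@fsbigE _ _ _ _ _ [seq om ^+ (k : 'I_n.+1) | k <- enum 'I_n.+1]) /=.
- rewrite big_map big_enum_cond /=; apply: eq_bigl => k.
  by rewrite mem_set //= exprAC (prim_expr_order prim) expr1n.
- by rewrite map_inj_uniq ?enum_uniq.
- by move=> w /= /mapP[k _ ->]; rewrite exprAC (prim_expr_order prim) expr1n.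
move=> w /= w1; have [k ->] := prim_rootP prim w1.
have h : om ^+ k \in [seq om ^+ (i : 'I_n.+1) | i <- enum 'I_n.+1].
  by apply/mapP; exists k; rewrite ?mem_enum.
by rewrite h.
Qed.

End Constants.

(** * Change of quad types *)

Section Quads.
Variable R : realType.
Local Notation C := R[i].

(** [d z / d (shape z r)], as [zeta z p] is the logarithmic derivative of
    [shape z p] with respect to [z]. *)
Definition shape_factor (z : C) (r : 'I_3) : C :=
  match val r with 0%N => 1 | 1%N => (1 - z) ^+ 2 | _ => z ^+ 2 end.

(** Chain rule for logarithmic derivatives: taking [r] and then [p] primes amounts to [r + p]
    primes. *)
Lemma zeta_shape (z : C) (r p : 'I_3) : z != 0 -> z != 1 ->
  zeta (shape z r) p = shape_factor z r * zeta z (r + p).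
Proof.
move=> z0 z1; have z1' : z - 1 != 0 by rewrite subr_eq0.
have z1'' : 1 - z != 0 by rewrite subr_eq0 eq_sym.
case: r => [[|[|[|//]]] rlt]; case: p => [[|[|[|//]]] plt];
  rewrite /zeta /shape /shape_factor /= ?mul1r ?modn_small //=; try (by field; rewrite ?z0 ?z1').
- have -> : 1 - (1 - z)^-1 = - z / (1 - z) by field.
  by field; rewrite z0 z1' z1''.
- by rewrite subKr invrK; field.
- have -> : (1 - z^-1) * (1 - z^-1 - 1) = (1 - z) / z ^+ 2 by field.
  by field; rewrite z0 z1''.
Qed.

Lemma shape_factor_neq0 z r : z != 0 -> z != 1 -> shape_factor z r != 0.
Proof.
move=> z0 z1; rewrite /shape_factor; case: (val r) => [|[|_]]; rewrite ?oner_eq0 ?expf_neq0 //.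
by rewrite subr_eq0 eq_sym.
Qed.

Lemma zeta_neq0 (z : C) p : z != 0 -> z != 1 -> zeta z p != 0.
Proof.
move=> z0 z1; rewrite /zeta; case: (val p) => [|[|_]]; rewrite invr_eq0 ?mulf_neq0 ?subr_eq0 //.
by rewrite eq_sym.
Qed.

End Quads.

Lemma laurent_combination (K : fieldType) (I : finType) (N : I -> int -> nat) (w : I -> K) (x : K) :
  (forall p, finite_set [set k | N p k != 0%N]%classic) ->
  \sum_p (\sum_(k \in [set: int]%classic) (N p k)%:R * x ^ k) * w p =
  \sum_(k \in [set: int]%classic) (\sum_p (N p k)%:R * w p) * x ^ k.
Proof.
move=> finN; pose A := (\bigcup_(p in [set: I]) [set k | N p k != 0%N])%classic.
have finA : finite_set A by apply: bigcup_finite => //; apply: finite_finset.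
have N0 p k : k \notin fset_set A -> N p k = 0%N.
  rewrite in_fset_set // => kA; apply/eqP; apply: contraNT kA => ne.
  by rewrite mem_set //; exists p.
rewrite [RHS](@fsbigTE _ _ _ _ (fset_set A)); last first.
  by move=> k kA; rewrite big1 ?mul0r // => p _; rewrite N0 // mul0r.
transitivity (\sum_p \sum_(k <- fset_set A) (N p k)%:R * x ^ k * w p).
  apply: eq_bigr => p _; rewrite (@fsbigTE _ _ _ _ (fset_set A)) ?mulr_suml // => k kA.
  by rewrite N0 // mul0r.
rewrite exchange_big; apply: eq_bigr => k _ /=; rewrite mulr_suml.
by apply: eq_bigr => p _; rewrite mulrAC.
Qed.

Section Numerators.
Variables (R : realType) (D : finType) (T : gluing D) (a : D -> 'I_4 -> int).
Variables (q : D -> 'I_3) (s : D -> int) (e : 'I_#|D| -> tedge (D * int)) (z : D -> R[i]).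
Hypothesis oT : oriented_gluing T.
Hypothesis ca : cocycle T a.
Local Notation Tinf := (infinite_cyclic_cover T a).
Local Notation K := (Ct R).

Definition edge_coef (i : 'I_#|D|) (j : D) (h : int) : K :=
  \sum_p (nedges Tinf (j, h) (q j + p) (e i))%:R * cst (zeta (z j) p).

Lemma edge_coef_support i j : finite_set [set h | edge_coef i j h != 0]%classic.
Proof.
apply: (@sub_finite_set _ _ (\bigcup_(p in [set: 'I_3])
    [set h | nedges Tinf (j, h) (q j + p) (e i) != 0%N])%classic); last first.
  by apply: bigcup_finite => [|p _]; [apply: finite_finset|apply: nedges_finite_support].
move=> h /=; have [[p ne]|no] := pselect (exists p, nedges Tinf (j, h) (q j + p) (e i) != 0%N).
  by exists p.
rewrite /edge_coef big1 ?eqxx // => p _; have -> : nedges Tinf (j, h) (q j + p) (e i) = 0%N.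
  by apply/eqP; apply/negPn/negP => ne; apply: no; exists p.
by rewrite mul0r.
Qed.

Lemma twisted_gluing_mxE x :
  \sum_p twisted_gluing_mx T a q s e p x *m diag_mx (\row_j cst (zeta (z (enum_val j)) p)) =
  laurent_mx edge_coef s x.
Proof.
apply/matrixP => i j; rewrite summxE [RHS]mxE.
rewrite -(laurent_combination
  (N := fun p k => nedges Tinf (enum_val j, s (enum_val j) + k) (q (enum_val j) + p) (e i))).
  apply: eq_bigr => p _; rewrite mul_mx_diag !mxE; congr (_ * _).
  by apply: eq_fsbigr => k _; rewrite mxE.
move=> p; apply: (@finite_preimage _ _
  [set h | nedges Tinf (enum_val j, h) (q (enum_val j) + p) (e i) != 0%N]%classic
  (fun k => s (enum_val j) + k)); last exact: nedges_finite_support.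
by move=> k k' _ _; apply: addrI.
Qed.

Section CoverNumerator.
Variables (n : nat) (b : D * 'I_n.+1 -> 'I_4 -> int) (q' : D * 'I_n.+1 -> 'I_3).
Variables (s' : D * 'I_n.+1 -> int).
Variable e' : 'I_#|{: D * 'I_n.+1}| -> tedge (D * 'I_n.+1 * int).
Variable r : D * 'I_n.+1 -> int.
Hypothesis r_residue : forall x, residue (r x) = x.2.
Hypothesis rS : forall x f,
  r (cyclic_cover T a n x f).1 = r x + (a x.1 f - n.+1%:Z * b x f).
Variables (pi : 'I_#|{: D * 'I_n.+1}| -> 'I_#|D|) (eta : 'I_#|{: D * 'I_n.+1}| -> int).
Hypothesis position : forall i,
  edge_eq Tinf (map_edge (unwrap r) (e' i)) (map_edge (shift (eta i)) (e (pi i))).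
Hypothesis z_ok : forall j, z j != 0 /\ z j != 1.
Local Notation Tcyc := (cyclic_cover T a n).

Let sigma x := n.+1%:Z * s' x + r x.

Lemma nedges_unwrap i x h k :
  nedges (infinite_cyclic_cover Tcyc b) (x, s' x + h) k (e' i) =
  nedges Tinf (x.1, sigma x + n.+1%:Z * h - eta i) k (e (pi i)).
Proof.
rewrite -(nedges_iso _ _ _ (unwrap_morphism rS) (unwrapK r_residue) (rewrapK r_residue)).
rewrite (nedges_class _ _ (position i)) nedges_shift /unwrap /sigma /=.
by congr (nedges _ (_, _ - _) _ _); ring.
Qed.

(** Changing the quad type of a tetrahedron permutes the three summands of its column and multiplies
    the column by a shape factor. *)
Lemma cover_twisted_gluing_mxE (t : K) :
  \sum_p twisted_gluing_mx Tcyc b q' s' e' p (t ^+ n.+1)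
    *m diag_mx (\row_x cst (zeta (lift_shape q z q' (enum_val x)) p)) =
  unwrapped_mx t edge_coef pi eta sigma
    *m diag_mx (\row_x cst (shape_factor (z (enum_val x).1) (q' (enum_val x) - q (enum_val x).1))).
Proof.
apply/matrixP => i y; rewrite summxE mul_mx_diag [RHS]mxE [X in _ = X * _]mxE [X in _ = _ * X]mxE.
set x := enum_val y; have [z0 z1] := z_ok x.1.
pose N p k := nedges Tinf (x.1, sigma x + n.+1%:Z * k - eta i) (q x.1 + p) (e (pi i)).
have finN p : finite_set [set k | N p k != 0%N]%classic.
  apply: (@finite_preimage _ _
    [set h | nedges Tinf (x.1, h) (q x.1 + p) (e (pi i)) != 0%N]%classic
    (fun k => sigma x + n.+1%:Z * k - eta i)); last exact: nedges_finite_support.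
  by move=> k k' _ _ /addIr/addrI/mulfI; apply.
rewrite -(laurent_combination _ _ finN) mulr_suml.
rewrite [RHS](reindex_inj (addrI (q' x - q x.1))); apply: eq_bigr => p _ /=.
rewrite mul_mx_diag [LHS]mxE [X in X * _ = _]mxE [X in _ * X = _]mxE.
rewrite /lift_shape zeta_shape // rmorphM -/x mulrCA [RHS]mulrC; congr (_ * _).
congr (_ * _); apply: eq_fsbigr => k _; rewrite mxE nedges_unwrap /N -/x.
have -> // : q x.1 + (q' x - q x.1 + p) = q' x + p.
by rewrite addrA; congr (_ + _); rewrite addrC subrK.
Qed.

End CoverNumerator.
End Numerators.

(** * Denominators *)

(** For edges the cardinality holds because both triangulations have as many edges as tetrahedra.
    The injection is then bijective, and each fibre is a copy of ['I_n]. *)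
Lemma card_fiber (I J : finType) n (pi : I -> J) (rho : I -> 'I_n) :
  injective (fun i => (pi i, rho i)) -> #|I| = (#|J| * n)%N ->
  forall j, #|[set i | pi i == j]| = n.
Proof.
move=> inj cardI j.
have [h hK Kh] : bijective (fun i => (pi i, rho i)).
  by apply: inj_card_bij => //; rewrite card_prod card_ord cardI.
have -> : [set i | pi i == j] = [set h (j, k) | k : 'I_n].
  apply/setP => i; rewrite inE; apply/eqP/imsetP => [<-|[k _ ->]].
    by exists (rho i); rewrite // (hK i).
  by have /(congr1 fst) := Kh (j, k).
by rewrite card_imset ?card_ord // => k k' /(can_inj Kh)[].
Qed.

Section Pushforward.
Variables (D : finType) (T : gluing D) (A : finZmodType) (a : D -> 'I_4 -> A).
Variable (e : 'I_#|D| -> tedge D).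
Variable (e' : 'I_#|{: D * A}| -> tedge (D * A)).
Variable pi : 'I_#|{: D * A}| -> 'I_#|D|.
Hypothesis eT : edge_enum T e.
Hypothesis eT' : edge_enum (cover T a) e'.
Hypothesis piE : forall i, edge_eq T (map_edge fst (e' i)) (e (pi i)).

(** Each edge of the lifted tetrahedron [(j, c)] belongs to exactly one class [e' i'], and this
    class lies over the class of the projected edge. *)
Lemma nedges_cover j c k i :
  nedges T j k (e i) = (\sum_(i' | pi i' == i) nedges (cover T a) (j, c) k (e' i'))%N.
Proof.
rewrite /nedges -sum1_card big_mkcond /=.
transitivity (\sum_(uv : 'I_4 * 'I_4) \sum_(i' | pi i' == i)
   nat_of_bool [&& (uv.1 < uv.2)%N, quad uv.1 uv.2 == k
                 & `[< edge_eq (cover T a) ((j, c), uv) (e' i') >]])%N.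
  apply: eq_bigr => uv _; rewrite inE.
  have [lt|ge] := ltnP uv.1 uv.2; last by rewrite /= big1.
  have [_|_] /= := boolP (quad uv.1 uv.2 == k); last by rewrite big1.
  have ne : uv.1 != uv.2 by rewrite neq_ltn lt.
  have [i0 [h0 U0]] := eT'.2 ((j, c), uv) ne.
  have h1 : edge_eq T (j, uv) (e (pi i0)).
    by apply: rst_trans (edge_eq_map (cover_proj T a) h0) (piE i0).
  have -> : `[< edge_eq T (j, uv) (e i) >] = (pi i0 == i).
    have [i1 [_ U1]] := eT.2 (j, uv) ne.
    by apply/asboolP/eqP => [h|<-//]; rewrite -(U1 _ h1) -(U1 _ h).
  have i0E i' : `[< edge_eq (cover T a) ((j, c), uv) (e' i') >] = (i' == i0).
    by apply/asboolP/eqP => [/U0 ->|->].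
  under eq_bigr do rewrite i0E.
  have [pe|pne] := boolP (pi i0 == i).
    by rewrite (bigD1 i0) //= eqxx big1 // => i' /andP[_ /negbTE ->].
  rewrite big1 // => i' /eqP pi'; case: eqP => // e0.
  by rewrite -e0 pi' eqxx in pne.
rewrite exchange_big; apply: eq_bigr => i' _ /=.
rewrite -sum1_card [RHS]big_mkcond /=; apply: eq_bigr => uv _.
by rewrite inE; case: [&& _, _ & _].
Qed.

Lemma edge_sum_pushforward (V : zmodType) (F : D * A -> 'I_3 -> V) i :
  edge_sum T (fun j k => \sum_c F (j, c) k) (e i) =
  \sum_(i' | pi i' == i) edge_sum (cover T a) F (e' i').
Proof.
rewrite /edge_sum [RHS]exchange_big /=.
transitivity (\sum_j \sum_c \sum_(i' | pi i' == i)
  \sum_k F (j, c) k *+ nedges (cover T a) (j, c) k (e' i')); last first.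
  by rewrite pair_big; apply: eq_bigr => -[].
apply: eq_bigr => j _.
under [RHS]eq_bigr do rewrite exchange_big /=.
rewrite [RHS]exchange_big; apply: eq_bigr => k _ /=.
rewrite -sumrMnl; apply: eq_bigr => c _.
by rewrite (nedges_cover j c k i) -sumrMnr.
Qed.

End Pushforward.

Section Denominators.
Variables (R : realType) (D : finType) (T : gluing D) (a : D -> 'I_4 -> int).
Variables (q : D -> 'I_3) (e : 'I_#|D| -> tedge D) (z : D -> R[i]) (f : 'I_3 -> 'cV[int]_#|D|).
Variables (n : nat) (q' : D * 'I_n.+1 -> 'I_3).
Variable e' : 'I_#|{: D * 'I_n.+1}| -> tedge (D * 'I_n.+1).
Variable f' : 'I_3 -> 'cV[int]_#|{: D * 'I_n.+1}|.
Variable pi : 'I_#|{: D * 'I_n.+1}| -> 'I_#|D|.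
Local Notation Tcyc := (cyclic_cover T a n).
Hypothesis oT : oriented_gluing T.
Hypothesis eT : edge_enum T e.
Hypothesis eT' : edge_enum Tcyc e'.
Hypothesis piE : forall i, edge_eq T (map_edge fst (e' i)) (e (pi i)).
Hypothesis pi_card : forall i, #|[set i' | pi i' == i]| = n.+1.
Hypothesis logz : log_gluing_equations T q e z.
Hypothesis flatf : flattening T q R e f.
Hypothesis flatf' : flattening Tcyc q' R e' f'.
Hypothesis z_ok : forall j, z j != 0 /\ z j != 1.

(** Sum over the sheets of [f'] minus the lift of [f], with [f'] read at the quad that has [p]
    primes for [q]. *)
Definition flattening_defect (p : 'I_3) : 'cV[int]_#|D| :=
  \col_j \sum_c (by_quad q' f' (enum_val j, c) (q (enum_val j) + p) - f p j 0).

Lemma by_quad_defect j k : by_quad q flattening_defect j k =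
  \sum_c by_quad q' f' (j, c) k - by_quad q f j k *+ n.+1.
Proof.
have e1 : q j + (k - q j) = k by rewrite addrC subrK.
by rewrite /by_quad mxE enum_rankK e1 sumrB sumr_const card_ord.
Qed.

(** The right-hand sides cancel: an edge has [n.+1] lifts, each with right-hand side [2], and a
    tetrahedron has [n.+1] lifts, each with sum [1]. *)
Lemma flattening_defect_kernel : \sum_p flattening_defect p = 0 /\
  \sum_p gluing_mx T q e p *m flattening_defect p = 0.
Proof.
have [fe fs _] := flatf; have [fe' fs' _] := flatf'.
have intr_id m1 m2 (M : 'M[int]_(m1, m2)) : map_mx intr M = M.
  by apply/matrixP => i k; rewrite mxE intz.
split.
  apply/matrixP => j k; rewrite ord1 [RHS]mxE -(enum_valK j) -(sum_by_quad q).
  under eq_bigr do rewrite by_quad_defect.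
  rewrite sumrB sumrMnl sum_by_quad fs exchange_big /=.
  under eq_bigr do rewrite sum_by_quad fs' mxE.
  by rewrite sumr_const card_ord mxE subrr.
apply/matrixP => i k; rewrite ord1 [RHS]mxE.
have sumE (X : 'I_3 -> 'cV[int]_#|D|) : (\sum_p gluing_mx T q e p *m X p) i 0 =
    edge_sum T (by_quad q X) (e i).
  by rewrite -gluing_mx_mul; under [in RHS]eq_bigr do rewrite intr_id.
rewrite sumE.
transitivity (edge_sum T (fun j k => \sum_c by_quad q' f' (j, c) k) (e i)
   - edge_sum T (by_quad q f) (e i) *+ n.+1).
  rewrite /edge_sum -sumrMnl -sumrB; apply: eq_bigr => j _.
  rewrite -sumrMnl -sumrB; apply: eq_bigr => k' _.
  by rewrite by_quad_defect mulrnBl mulrnAC.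
rewrite (edge_sum_pushforward eT eT' piE) -sumE fe mxE.
rewrite (eq_bigr (fun=> 2)); last first.
  move=> i' _; rewrite -gluing_mx_mul.
  by under eq_bigr do rewrite intr_id; rewrite fe' mxE.
have -> : \sum_(i' | pi i' == i) (2 : int) = 2 *+ n.+1.
  rewrite sumr_const; congr (_ *+ _); rewrite -[RHS](pi_card i).
  by apply: eq_card => i'; rewrite inE.
by rewrite subrr.
Qed.

Local Notation K := (Ct R).

(** As the entries of [f'] at a tetrahedron sum to [1], its shape factor comes out once. The
    remaining exponents sum over the sheets to [n.+1] times [f] plus the defect, which only
    contributes a sign. *)
Lemma cover_denominator : exists b : bool,
  \prod_x \prod_p cst (zeta (lift_shape q z q' (enum_val x)) p) ^ f' p x 0 =
  (-1) ^+ b * \prod_(x < #|{: D * 'I_n.+1}|)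
     cst (shape_factor (z (enum_val x).1) (q' (enum_val x) - q (enum_val x).1)) *
  (\prod_j \prod_p cst (zeta (z (enum_val j)) p) ^ f p j 0) ^+ n.+1 :> K.
Proof.
have [d0 de] := flattening_defect_kernel.
have [b bE] := zeta_flattening_sign oT eT logz flatf d0 de.
exists b.
have [_ fs' _] := flatf'.
pose g x p := by_quad q' f' x (q x.1 + p).
have step x : \prod_p cst (zeta (lift_shape q z q' (enum_val x)) p) ^ f' p x 0 =
    cst (shape_factor (z (enum_val x).1) (q' (enum_val x) - q (enum_val x).1)) *
    cst (\prod_p zeta (z (enum_val x).1) p ^ g (enum_val x) p) :> K.
  set y := enum_val x; have [z0 z1] := z_ok y.1.
  have k0 : shape_factor (z y.1) (q' y - q y.1) != 0 by apply: shape_factor_neq0.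
  rewrite -rmorphM.
  transitivity (cst (\prod_p (shape_factor (z y.1) (q' y - q y.1) *
     zeta (z y.1) (q' y - q y.1 + p)) ^ f' p x 0) : K).
    rewrite rmorph_prod; apply: eq_bigr => p _.
    by rewrite fmorphXz /lift_shape zeta_shape.
  congr cst; under eq_bigr do rewrite expfzMl.
  rewrite big_split /=; congr (_ * _).
    rewrite -(big_morph (fun m : int => shape_factor (z y.1) (q' y - q y.1) ^ m)
      (fun m1 m2 => expfzDr m1 m2 k0) (expr0z _)).
    by have := congr1 (fun M : 'cV[int]__ => M x 0) fs'; rewrite summxE mxE => ->.
  rewrite [RHS](reindex_inj (addrI (q' y - q y.1))); apply: eq_bigr => p _ /=.
  congr (_ ^ _); rewrite /g /by_quad /y enum_valK; congr (f' _ _ _).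
  by rewrite -/y addrA [q y.1 + _]addrC subrK addrAC subrr add0r.
under eq_bigr do rewrite step.
rewrite big_split /= [in RHS](mulrC ((-1) ^+ b)) -mulrA; congr (_ * _).
rewrite -(rmorph_sign (@cst R)) -bE -rmorph_prod /=.
have -> : \prod_j \prod_p cst (zeta (z (enum_val j)) p) ^ f p j 0 =
    cst (\prod_j \prod_p zeta (z (enum_val j)) p ^ f p j 0).
  rewrite rmorph_prod; apply: eq_bigr => j _; rewrite rmorph_prod; apply: eq_bigr => p _.
  by rewrite fmorphXz.
rewrite -rmorphXn -rmorphM; congr cst.
rewrite -prodrXl -big_split /=.
have prod_enum_val (I : finType) (F : I -> R[i]) :
    \prod_(i < #|I|) F (enum_val i) = \prod_i F i.
  rewrite [RHS](reindex (@enum_val I I)) //=; by apply: onW_bij; apply: enum_val_bij.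
rewrite (prod_enum_val _ (fun x => \prod_p zeta (z x.1) p ^ g x p)).
transitivity (\prod_j \prod_(c : 'I_n.+1) \prod_p zeta (z j) p ^ g (j, c) p).
  rewrite (pair_big xpredT xpredT (fun j c => \prod_p zeta (z j) p ^ g (j, c) p)) /=.
  by apply: eq_bigr => -[].
rewrite -prod_enum_val; apply: eq_bigr => j _.
rewrite exchange_big -prodrXl -big_split; apply: eq_bigr => p _ /=.
have [z0 z1] := z_ok (enum_val j); have zn : zeta (z (enum_val j)) p != 0 by apply: zeta_neq0.
rewrite -(big_morph (fun m : int => zeta (z (enum_val j)) p ^ m)
  (fun m1 m2 => expfzDr m1 m2 zn) (expr0z _)).
rewrite exprnP exprz_exp -expfzDr // mxE; congr (_ ^ _).
by rewrite sumrB sumr_const card_ord mulrC -mulr_natl natz subrK.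
Qed.

End Denominators.

(** * Comparison of numerators and denominators *)

Lemma signed_quotient (K : fieldType) (b c : bool) (v x k y : K) : k != 0 ->
  (-1) ^+ c * v * x * k / ((-1) ^+ b * k * y) = (-1) ^+ b * (-1) ^+ c * v * (x / y).
Proof. by move=> k0; rewrite !invfM invr_sign -[RHS]mulr1 -(divff k0); ring. Qed.

Theorem theorem1p6 (R : realType) (D : finType) (T : gluing D)
  (a : D -> 'I_4 -> int)
  (q : D -> 'I_3) (s : D -> int) (e : 'I_#|D| -> tedge (D * int))
  (z : D -> R[i]) (f : 'I_3 -> 'cV[int]_#|D|)
  (m : nat) (mu : 'I_m.+1 -> arc D)
  (n : nat) (b : D * 'I_n.+1 -> 'I_4 -> int)
  (q' : D * 'I_n.+1 -> 'I_3) (s' : D * 'I_n.+1 -> int)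
  (e' : 'I_#|{: D * 'I_n.+1}| -> tedge (D * 'I_n.+1 * int))
  (f' : 'I_3 -> 'cV[int]_#|{: D * 'I_n.+1}|) :
  ideal_triangulation T ->
  edge_lifts T e ->
  supports_geometric T q (proj_edge \o e) z ->
  epimorphism T a ->
  peripheral_curve T R mu ->
  evalc T a (mu ord0).1.1 (curve_word mu) = 1 ->
  flattening T q R (proj_edge \o e) f ->
  divided_cocycle T a b ->
  edge_lifts (cyclic_cover T a n) e' ->
  flattening (cyclic_cover T a n) q' R (proj_edge \o e') f' ->
  eq_upto_unit
    (tau (cyclic_cover T a n) b q' s' e' (lift_shape q z q') f'
         (indet R ^+ n.+1))
    (\big[*%R/1]_(w \in [set w : R[i] | w ^+ n.+1 = 1]%classic)
        tau T a q s e z f (cst w * indet R)).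
Proof.
move=> [oT _] lift_e [z_ok logz _] [ca _] _ _ flatf db lift_e' flatf'.
have [r [r_residue rS]] := height_potential oT ca db.
have [pi [eta [position inj]]] := edge_position r_residue rS lift_e lift_e'.
have piE i : edge_eq T (map_edge fst (proj_edge (e' i))) (proj_edge (e (pi i))).
  exact: edge_eq_map (cover_proj T a) (position i).
have pi_card i : #|[set i' | pi i' == i]| = n.+1.
  by apply: (card_fiber inj); rewrite !card_ord card_prod card_ord.
have [bD denE] := cover_denominator oT lift_e lift_e' piE pi_card logz flatf flatf' z_ok.
have [om prim] := primitive_root_exists R n.
have prim' : n.+1.-primitive_root (cst om) by rewrite fmorph_primitive_root.
pose sigma x := n.+1%:Z * s' x + r x.
have sigma_residue x : residue (sigma x) = x.2 by rewrite residueD residueM add0r.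
have [u [b0 [r0 uE]] detE] := det_unwrapped_mx prim' (natr_Ct_neq0 R n) (indet_neq0 R) s
  (edge_coef_support q e z oT ca) inj sigma_residue.
rewrite (prod_unity_roots _ prim) /tau.
under [X in eq_upto_unit _ X]eq_bigr do rewrite twisted_gluing_mxE // rmorphXn.
rewrite prodf_div prodr_const card_ord denE.
rewrite (cover_twisted_gluing_mxE q oT ca q' s' r_residue rS position z_ok).
rewrite det_mulmx det_diag detE uE.
under [X in _ * X / _]eq_bigr do rewrite mxE.
exists (bD (+) b0), r0; rewrite signr_addb.
(* The product [kap] of the shape factors occurs in both the determinant and the denominator of the
   cover, and cancels. *)
set X := \prod_(w < n.+1) _; set kap := \prod_(x < _) _; set den := \prod_j _.
have kap0 : kap != 0.
  apply/prodf_neq0 => x _; have [z0 z1] := z_ok (enum_val x).1.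
  by rewrite fmorph_eq0 shape_factor_neq0.
exact: signed_quotient.
Qed.
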